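(* Let $\varphi^*$ be the unitary totient function, and let $F_{\varphi^*}(X)$ denote the number of $\varphi^*$-practical positive integers $n\le X$. There exist positive constants $l$ and $u$ such that $$ l\,\frac{X}{\log X}\le F_{\varphi^*}(X)\le u\,\frac{X}{\log X}$$ for all real $X\ge 2$.
   Context: The unitary totient function $\varphi^*$ is the multiplicative function with $\varphi^*(1)=1$ and $\varphi^*(p^k)=p^k-1$ for every prime $p$ and integer $k\ge1$. For a multiplicative $f$ put $S_f(n)=\sum_{d\mid n}f(d)$. A positive integer $n$ is $f$-practical if every positive integer $m\le S_f(n)$ can be written as $\sum_{d\in\mathcal{D}} f(d)$ for some set $\mathcal{D}$ of distinct positive divisors of $n$. *)

(* Defs.v *)
From mathcomp Require Import all_boot.
Set Implicit Arguments. Unset Strict Implicit. Unset Printing Implicit Defensive.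

(* Unitary totient: multiplicative, phi*(1) = 1, phi*(p^k) = p^k - 1.
   Written via the prime factorization n = prod_p p^(logn p n). *)
Definition ustar (n : nat) : nat :=
  \prod_(p <- primes n) (p ^ logn p n - 1).

Definition Sf (f : nat -> nat) (n : nat) : nat :=
  \sum_(d <- divisors n) f d.

Definition f_practical (f : nat -> nat) (n : nat) : bool :=
  [forall m : 'I_(Sf f n).+1, (0 < m) ==>
     [exists D : {set 'I_n.+1},
        (D \subset [set d : 'I_n.+1 | (0 < d) && (d %| n)]) &&
        (\sum_(d in D) f d == m)]].

Definition F_count (f : nat -> nat) (N : nat) : nat :=
  count (f_practical f) (iota 1 N).

(* Main.v *)
From mathcomp Require Import all_boot all_order all_algebra.
From mathcomp Require Import reals sequences exp.
From mathcomp Require Import ring lra zify.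
Require Import Defs.
Set Implicit Arguments. Unset Strict Implicit. Unset Printing Implicit Defensive.
Import Order.TTheory GRing.Theory Num.Theory.
Local Open Scope ring_scope.

(* Write S(n) for [Sf ustar n] and, for n = m r with m the part of n made of the primes below p, call
   m a prefix. If n is practical then p <= S(m) + 2 for each prime p dividing n; conversely
   p <= m for all odd p, together with a good start at the prime 2, suffices.

   Choose n at random, prime by prime, with independent geometric exponents. For phi = ln S or
   phi = ln, the quantity phi(m) - Lam(p), with Lam(p) the mean of phi(m), is a martingale, and by
   Mertens Lam(p) = ln p + O(1). The two conditions above say, up to constants, that n survives as
   long as the martingale stays above a barrier. By optional stopping its mean on survival up to y
   is bounded above, and below when started above the barrier. Since a survivor can be moved to
   distance about ln y from the barrier at bounded cost (multiply by one prime between sqrt y and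
   y), survival up to y has probability O(1 / ln y). This controls the quadratic variation and
   gives: the survivors m at level y satisfy sum 1/m = O(1) and sum (ln m)^2/m = O((ln y)^2).

   Upper bound: a practical n in (x/2, x] is m p with p its largest prime, and m is a survivor.
   Chebyshev bounds the number of p for given m, and the second moment handles small p.
   Lower bound: sum 1/m over survivors m <= y^H is bounded below; multiplying by primes in
   (sqrt y, y] transports this mass to m between sqrt N and y sqrt N, and each prime q in
   (y, N/m] then gives a practical number m q <= N, with bounded multiplicity. *)

(** * Chebyshev and Mertens estimates *)

Definition lg (R : realType) (n : nat) : R := ln (n%:R : R).

Section Logarithm.
Variable R : realType.
Local Notation lg := (lg R).

Lemma lg0 : lg 0 = 0. Proof. exact: ln0. Qed.
Lemma lg1 : lg 1 = 0. Proof. exact: ln1. Qed.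

Lemma lgM m n : (0 < m)%N -> (0 < n)%N -> lg (m * n) = lg m + lg n.
Proof. by move=> m0 n0; rewrite /lg natrM lnM // posrE ltr0n. Qed.

Lemma lgX m k : (0 < m)%N -> lg (m ^ k) = k%:R * lg m.
Proof. by move=> m0; rewrite /lg natrX lnXn ?ltr0n // mulr_natl. Qed.

Lemma lg_ge0 n : 0 <= lg n.
Proof. by case: n => [|n]; rewrite ?lg0 // ln_ge0 // ler1n. Qed.

Lemma le_lg m n : (m <= n)%N -> lg m <= lg n.
Proof.
case: m => [|m] mn; first by rewrite lg0 lg_ge0.
by rewrite /lg ler_ln ?posrE ?ltr0n ?ler_nat //; apply: leq_trans mn.
Qed.

Lemma lg_gt0 n : (1 < n)%N -> 0 < lg n.
Proof. by move=> n1; rewrite ln_gt0 // ltr1n. Qed.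

Lemma ler_lg_nat m n : (0 < m)%N -> (0 < n)%N -> (lg m <= lg n) = (m <= n)%N.
Proof. by move=> m0 n0; rewrite /lg ler_ln ?posrE ?ltr0n // ler_nat. Qed.

Lemma ln_ge_subV (x : R) : 0 < x -> 1 - x^-1 <= ln x.
Proof.
move=> x0; have xV0 : 0 < x^-1 by rewrite invr_gt0.
have := @le_ln1Dx R (x^-1 - 1); rewrite (addrC 1) subrK lnV ?posrE // => H.
by have := H ltac:(lra); lra.
Qed.

Lemma lgS_le n : (0 < n)%N -> lg n.+1 <= lg n + n%:R^-1.
Proof.
move=> n0; have n0R : 0 < n%:R :> R by rewrite ltr0n.
rewrite /lg; have -> : n.+1%:R = n%:R * (1 + n%:R^-1) :> R.
  by rewrite mulrDr mulr1 divff ?gt_eqF // -addn1 natrD.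
have nV0 : 0 < n%:R^-1 :> R by rewrite invr_gt0.
rewrite lnM ?posrE // ?addr_gt0 // lerD2l.
by apply: le_ln1Dx; lra.
Qed.

Lemma lg_lt n : (0 < n)%N -> lg n < n%:R.
Proof. by move=> n0; apply: ln_sublinear; rewrite ltr0n. Qed.

Lemma lg2_le1 : lg 2 <= 1.
Proof. by have := @lgS_le 1 isT; rewrite lg1 invr1 add0r. Qed.

Lemma lg2_ge : 2^-1 <= lg 2.
Proof. by have := @ln_ge_subV 2 ltac:(lra); rewrite -/(lg 2); lra. Qed.

Lemma lg_ge_half n : (1 < n)%N -> 2^-1 <= lg n.
Proof. by move=> n1; apply: le_trans lg2_ge (le_lg n1). Qed.

End Logarithm.

Lemma prime_dvd_fact_leq p n : prime p -> (p %| n`!)%N -> (p <= n)%N.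
Proof.
move=> pp; elim: n => [|n IH]; first by rewrite fact0 dvdn1; case: eqP pp => // ->.
rewrite factS Euclid_dvdM // => /orP[/dvdn_leq -> //|/IH /leqW //].
Qed.

Lemma bin_odd_le m : ('C(m.*2.+1, m) <= 4 ^ m)%N.
Proof.
have := Pascal 1 1 m.*2.+1; rewrite addn1 => E.
have S : ('C(m.*2.+1, m) + 'C(m.*2.+1, m.+1) <= 2 ^ m.*2.+1)%N.
  rewrite E (bigD1 (inord m)) //= (bigD1 (inord m.+1)) /=; last first.
    by rewrite -val_eqE /= !inordK //; lia.
  rewrite !inordK; try lia.
  by rewrite !exp1n !muln1 addnA leq_addr.
have B : 'C(m.*2.+1, m.+1) = 'C(m.*2.+1, m).
  by rewrite -[RHS]bin_sub; [have -> : (m.*2.+1 - m = m.+1)%N by lia|lia].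
have : (2 ^ m.*2.+1 = 2 * 4 ^ m)%N by rewrite expnS -mul2n expnM.
lia.
Qed.

Lemma prod_primes_le (P : pred nat) n N : (0 < N)%N ->
  (forall p, (p <= n)%N -> P p -> prime p /\ (p %| N)%N) ->
  (\prod_(0 <= p < n.+1 | P p) p <= N)%N.
Proof.
move=> N0 H; pose pi : nat_pred := [pred p | P p && (p < n.+1)%N].
have -> : (\prod_(0 <= p < n.+1 | P p) p =
           \prod_(0 <= p < (maxn n N).+1 | p \in pi) p)%N.
  by rewrite (big_nat_widen _ _ (maxn n N).+1) // ltnS leq_maxl.
apply: (@leq_trans N`_pi); last by apply: dvdn_leq => //; apply: dvdn_part.
rewrite (widen_partn _ (leq_maxr n N)); apply: leq_prod => p /andP[Pp pn].
have [pp pN] := H p pn Pp.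
by rewrite -{1}(expn1 p) leq_exp2l ?prime_gt1 // -pfactor_dvdn // expn1.
Qed.

Lemma primorial_le n : (\prod_(0 <= p < n.+1 | prime p) p <= 4 ^ n)%N.
Proof.
elim/ltn_ind: n => n IH.
have [|n2] := leqP n 2.
  by case: n {IH} => [|[|[|]]] // _; rewrite unlock.
have [odd_n|ev] := boolP (odd n); last first.
  have n0 : (0 < n)%N by lia.
  rewrite big_mkcond big_nat_recr //= -big_mkcond /=.
  have -> : prime n = false.
    by apply/negbTE/negP => /even_prime; case; [lia|move=> on; rewrite on in ev].
  have := IH n.-1 ltac:(lia); rewrite prednK // muln1 => /leq_trans; apply.
  by rewrite leq_exp2l // leq_pred.
pose m := n./2; have nE : n = m.*2.+1 by rewrite /m; lia.
have {}n2 : (0 < m)%N by lia.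
rewrite nE (@big_cat_nat _ _ _ m.+2) //=; last lia.
have -> : (4 ^ m.*2.+1 = 4 ^ m.+1 * 4 ^ m)%N by rewrite -expnD; congr (_ ^ _)%N; lia.
apply: leq_mul; first by apply: IH; lia.
apply: leq_trans (bin_odd_le m).
rewrite -[X in (X <= _)%N]mul1n.
have -> : (\prod_(m.+2 <= p < m.*2.+2 | prime p) p =
  \prod_(0 <= p < m.*2.+2 | prime p && (m.+1 < p)) p)%N.
  rewrite [RHS](@big_cat_nat _ _ _ m.+2) //=; last lia.
  rewrite [X in _ = (X * _)%N]big_nat_cond [X in _ = (X * _)%N]big1 ?mul1n; last by move=> i; lia.
  by rewrite big_nat_cond [RHS]big_nat_cond; apply: eq_bigl => i; lia.
rewrite mul1n; apply: prod_primes_le; first by rewrite bin_gt0; lia.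
move=> p pm /andP[pp mp]; split=> //.
have : (p %| (m.*2.+1)`!)%N by apply: dvdn_fact; rewrite prime_gt0.
have mle : (m <= m.*2.+1)%N by lia.
rewrite -(bin_fact mle) Euclid_dvdM // => /orP[//|].
by rewrite Euclid_dvdM // => /orP[] /(prime_dvd_fact_leq pp); lia.
Qed.

Section Mertens.
Variable R : realType.
Local Notation lg := (lg R).

Lemma lg_prod (P : pred nat) (F : nat -> nat) m n :
  (forall i, P i -> (0 < F i)%N) ->
  lg (\prod_(m <= i < n | P i) F i) = \sum_(m <= i < n | P i) lg (F i).
Proof.
move=> F0; rewrite -(big_filter _ P) -[in RHS]big_filter.
have : all P [seq i <- index_iota m n | P i] by apply: filter_all.
elim: [seq _ <- _ | _] => [|i s IH] /=; first by rewrite !big_nil lg1.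
move=> /andP[Pi Ps]; rewrite !big_cons lgM ?F0 // ?IH //.
by rewrite big_seq_cond prodn_cond_gt0 // => j; rewrite andbT => /(allP Ps)/F0.
Qed.

Lemma theta_le n : \sum_(0 <= p < n.+1 | prime p) lg p <= 2 * n%:R.
Proof.
rewrite -lg_prod => [|p /prime_gt0 //].
apply: le_trans (le_lg R (primorial_le n)) _.
rewrite lgX // mulrC; apply: ler_wpM2r => //.
by rewrite (_ : 4 = 2 ^ 2)%N // lgX //; have := lg2_le1 R; lra.
Qed.

Lemma lg_factor n M : (0 < n <= M)%N ->
  lg n = \sum_(0 <= p < M.+1 | prime p) (logn p n)%:R * lg p.
Proof.
move=> /andP[n0 nM]; rewrite -{1}(partnT n0) (widen_partn _ nM) lg_prod; last first.
  by case=> [|i] _; rewrite ?expn_gt0 // lognE.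
rewrite [RHS]big_mkcond; apply: eq_bigr => p _.
case: ifP => [/prime_gt0 p0|pp]; first by rewrite lgX.
by rewrite lognE pp expn0 lg1.
Qed.

Lemma lg_fact n :
  lg n`! = \sum_(0 <= p < n.+1 | prime p) (logn p n`!)%:R * lg p.
Proof.
have nf : (n <= n`!)%N.
  by case: n => // n; rewrite factS leq_pmulr // fact_gt0.
rewrite (@lg_factor _ n`!) ?fact_gt0 //= (@big_cat_nat _ _ _ n.+1) //=.
rewrite [X in _ + X]big_nat_cond [X in _ + X]big1 ?addr0 // => p /andP[/andP[np _] pp].
rewrite lognE pp fact_gt0; case: ifP => [/(prime_dvd_fact_leq pp)|]; last by rewrite mul0r.
by rewrite leqNgt np.
Qed.

Lemma lg_fact_le n : lg n`! <= n%:R * lg n.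
Proof.
elim: n => [|n IH]; first by rewrite fact0 lg1 mul0r.
rewrite factS lgM ?fact_gt0 // -addn1 natrD mulrDl mul1r addrC lerD2r.
by apply: le_trans IH _; apply: ler_wpM2l => //; apply: le_lg; rewrite addn1.
Qed.

Lemma lg_fact_ge n : n%:R * lg n - n%:R <= lg n`!.
Proof.
elim: n => [|n IH]; first by rewrite fact0 lg1 mul0r subr0.
rewrite factS lgM ?fact_gt0 //.
case: n IH => [|n] IH; first by rewrite ?fact0 !lg1; lra.
have := @lgS_le R n.+1 isT; set a := lg n.+2; set b := lg n.+1 in IH *.
have n0 : 0 < n.+1%:R :> R by rewrite ltr0n.
rewrite -(ler_pM2l n0) mulrDr divff ?gt_eqF //.
have -> : n.+2%:R = n.+1%:R + 1 :> R by rewrite -[n.+2]addn1 natrD.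
by move: IH; lra.
Qed.

Lemma geom_sum_le (x : R) n : 0 <= x -> x < 1 ->
  \sum_(1 <= k < n.+1) x ^+ k <= x / (1 - x).
Proof.
move=> x0 x1; have d0 : 0 < 1 - x by lra.
rewrite ler_pdivlMr //.
suff -> : (\sum_(1 <= k < n.+1) x ^+ k) * (1 - x) = x - x ^+ n.+1.
  by rewrite lerBlDr lerDl exprn_ge0.
elim: n => [|n IH]; first by rewrite big_geq // mul0r subrr.
by rewrite big_nat_recr //= mulrDl IH [x ^+ n.+2]exprS; ring.
Qed.

Lemma logn_fact_le p n : prime p -> (logn p n`!)%:R <= n%:R / (p%:R - 1) :> R.
Proof.
move=> pp; rewrite logn_fact // natr_sum.
have p1 : 1 < p%:R :> R by rewrite ltr1n prime_gt1.
have pV1 : p%:R^-1 < 1 :> R by rewrite invf_lt1 //; lra.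
have pV0 : 0 <= p%:R^-1 :> R by rewrite invr_ge0.
apply: (@le_trans _ _ (\sum_(1 <= k < n.+1) n%:R * p%:R^-1 ^+ k)).
  apply: ler_sum => k _; rewrite exprVn ler_pdivlMr; last by apply: exprn_gt0; lra.
  by rewrite -natrX -natrM ler_nat leq_trunc_div.
rewrite -mulr_sumr; apply: ler_wpM2l => //.
apply: le_trans (geom_sum_le _ pV0 pV1) _.
rewrite le_eqVlt; apply/orP; left; apply/eqP; field; lra.
Qed.

Lemma sum_lg_div_sqr_le n : \sum_(0 <= p < n.+1 | prime p) lg p / p%:R ^+ 2 <= 2.
Proof.
suff H : (0 < n)%N ->
    \sum_(0 <= p < n.+1 | prime p) lg p / p%:R ^+ 2 <= 2 - (lg n + 2) / n%:R.
  case: n H => [_|n H]; first by rewrite big_mkcond big_nat1 /=.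
  by apply: le_trans (H isT) _; rewrite gerBl divr_ge0 // addr_ge0 // lg_ge0.
elim: n => [//|[_ _|n /(_ isT) IH _]].
  by rewrite unlock /= lg1; lra.
rewrite big_mkcond big_nat_recr //= -big_mkcond /=.
have Q : lg n.+2 / n.+2%:R ^+ 2 <= (lg n.+1 + 2) / n.+1%:R - (lg n.+2 + 2) / n.+2%:R.
  have n0 : 1 <= n.+1%:R :> R by rewrite ler1n.
  have -> : n.+2%:R = n.+1%:R + 1 :> R by rewrite -[n.+2]addn1 natrD.
  have := @lgS_le R n.+1 isT.
  move: (lg_ge0 R n.+2) n0; set a := lg n.+2; set b := lg n.+1.
  move: (n.+1%:R) => x a0 x1 ab.
  have -> : (b + 2) / x - (a + 2) / (x + 1) = (b * (x + 1) + 2 - a * x) / (x * (x + 1)).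
    by field; lra.
  have xV : x^-1 * x = 1 by rewrite mulVf //; lra.
  have xV1 : x^-1 <= 1 by rewrite invf_le1 //; lra.
  have h : a <= b * (x + 1) + 2 - a * x by nra.
  rewrite ler_pdivlMr ?mulr_gt0 //; [|lra|lra].
  have -> : a / (x + 1) ^+ 2 * (x * (x + 1)) = a * (x / (x + 1)) by field; lra.
  have : x / (x + 1) <= 1 by rewrite ler_pdivrMr; lra.
  by nra.
have Q0 := divr_ge0 (lg_ge0 R n.+2) (exprn_ge0 2 (ler0n R n.+2)).
move: (_ / _ ^+ 2) Q0 Q => q Q0 Q.
have Q1 : (if prime n.+2 then q else 0) <= q by case: ifP.
by move: Q1 Q IH; move: (\sum_(_ <= _ < _ | _) _) (if _ then _ else _) (_ / _) (_ / _) => *; lra.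
Qed.

Lemma mertens_upper n : (0 < n)%N ->
  \sum_(0 <= p < n.+1 | prime p) lg p / p%:R <= lg n + 2.
Proof.
move=> n0; have n0R : 0 < n%:R :> R by rewrite ltr0n.
rewrite -(ler_pM2l n0R) mulr_sumr.
apply: (@le_trans _ _ (\sum_(0 <= p < n.+1 | prime p) ((logn p n`!)%:R * lg p + lg p))).
  apply: ler_sum => p pp.
  have p0 : 0 < p%:R :> R by rewrite ltr0n prime_gt0.
  rewrite mulrCA [X in _ <= X](_ : _ = lg p * ((logn p n`!)%:R + 1)); last by ring.
  apply: ler_wpM2l; first exact: lg_ge0.
  rewrite ler_pdivrMr // natr1 -natrM ler_nat.
  apply: leq_trans (ltnW (ltn_ceil n (prime_gt0 pp))) _.
  rewrite leq_mul2r ltnS; apply/orP; right.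
  rewrite logn_fact //; case: (n) => [|k]; first by rewrite div0n.
  by rewrite big_nat_recl // expn1 leq_addr.
rewrite big_split /= -lg_fact mulrDr.
by apply: lerD; [apply: lg_fact_le | rewrite mulrC theta_le].
Qed.

Lemma mertens_lower n : (0 < n)%N ->
  lg n - 5 <= \sum_(0 <= p < n.+1 | prime p) lg p / p%:R.
Proof.
move=> n0; have n0R : 0 < n%:R :> R by rewrite ltr0n.
have H : lg n - 1 <= \sum_(0 <= p < n.+1 | prime p) lg p / (p%:R - 1).
  rewrite -(ler_pM2l n0R) mulr_sumr mulrBr mulr1.
  apply: le_trans (lg_fact_ge n) _; rewrite lg_fact; apply: ler_sum => p pp.
  rewrite mulrCA mulrC; apply: ler_wpM2l; [exact: lg_ge0|exact: logn_fact_le].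
have := sum_lg_div_sqr_le n.
suff : \sum_(0 <= p < n.+1 | prime p) lg p / (p%:R - 1) <=
  \sum_(0 <= p < n.+1 | prime p) lg p / p%:R +
   2 * \sum_(0 <= p < n.+1 | prime p) lg p / p%:R ^+ 2 by lra.
rewrite mulr_sumr -big_split /=; apply: ler_sum => p pp.
have p2 : 2 <= p%:R :> R by rewrite ler_nat prime_gt1.
rewrite mulrCA -mulrDr; apply: ler_wpM2l; first exact: lg_ge0.
rewrite -subr_ge0 [X in 0 <= X](_ : _ = (p%:R - 2) / (p%:R ^+ 2 * (p%:R - 1))); last first.
  by field; lra.
by apply: divr_ge0; [lra|]; apply: mulr_ge0; [apply: exprn_ge0; lra|lra].
Qed.

End Mertens.

Section PrimeProducts.
Variable R : realType.
Local Notation lg := (lg R).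

Let A (n : nat) : R := \sum_(0 <= p < n.+1 | prime p) lg p / p%:R.

Let dV (n : nat) : R := (lg n)^-1 - (lg n.+1)^-1.

Lemma sum_primes_abel n :
  \sum_(0 <= p < n.+3 | prime p) p%:R^-1 =
    A n.+2 / lg n.+2 + \sum_(2 <= k < n.+2) A k * dV k :> R.
Proof.
have lg2 : lg 2 != 0 by rewrite gt_eqF // lg_gt0.
elim: n => [|n IH].
  by rewrite [X in _ = _ + X]big_geq // addr0 /A unlock /=; field; rewrite ?lg2.
rewrite big_mkcond big_nat_recr //= -big_mkcond IH [in RHS]big_nat_recr //= /dV.
rewrite [A n.+3]/A [X in _ = X / _ + _]big_mkcond big_nat_recr //= -big_mkcond -/(A n.+2).
have h2 : lg n.+2 != 0 by rewrite gt_eqF // lg_gt0.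
have h3 : lg n.+3 != 0 by rewrite gt_eqF // lg_gt0.
have h : n.+3%:R != 0 :> R by rewrite pnatr_eq0.
by move: (A _) (\sum_(_ <= _ < _) _) (lg _) h2 (lg _) h3 (n.+3%:R) h => a s l2 h2 l3 h3 x h;
  case: ifP => _; field; rewrite ?h ?h2 ?h3.
Qed.

Lemma dV_ge0 n : (1 < n)%N -> 0 <= dV n.
Proof.
move=> n1; have a := lg_gt0 R n1; have b := lg_gt0 R (leqW n1).
by rewrite subr_ge0 lef_pV2 ?posrE //; apply: le_lg.
Qed.

Lemma sum_primeV_le n : (1 < n)%N ->
  \sum_(0 <= p < n.+1 | prime p) p%:R^-1 <= ln (lg n) + 10.
Proof.
case: n => [|[|n]] // _; rewrite sum_primes_abel.
have l0 k : 0 < lg k.+2 by rewrite lg_gt0.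
have H1 : A n.+2 / lg n.+2 <= 1 + 2 / lg n.+2.
  rewrite ler_pdivrMr // mulrDl mul1r -mulrA mulVf ?gt_eqF // mulr1.
  exact: mertens_upper.
have H2 : \sum_(2 <= k < n.+2) A k * dV k <=
    ln (lg n.+2) - ln (lg 2) + 2 * ((lg 2)^-1 - (lg n.+2)^-1).
  elim: n {H1} => [|n IH]; first by rewrite big_geq // !subrr mulr0 addr0.
  rewrite big_nat_recr //=; set S := \sum_(_ <= _ < _) _ in IH *.
  have := @mertens_upper R n.+2 isT; rewrite -/(A n.+2) => H.
  have D0 := @dV_ge0 n.+2 isT.
  have {}H := ler_wpM2r D0 H.
  have Q : lg n.+2 * dV n.+2 <= ln (lg n.+3) - ln (lg n.+2).
    rewrite /dV -ln_div ?posrE // mulrBr divff ?gt_eqF //.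
    have := @ln_ge_subV R (lg n.+3 / lg n.+2) (divr_gt0 (l0 _) (l0 _)).
    by rewrite invf_div.
  by move: H Q IH; rewrite mulrDl /dV; lra.
have q : (lg 2)^-1 <= 2.
  by rewrite -[2]invrK lef_pV2 ?posrE ?lg2_ge ?lg_gt0 //; lra.
have r : - ln (lg 2) <= 1.
  by have := ln_ge_subV (l0 0%N); lra.
move: H1 H2 q r; rewrite mulrBr.
by lra.
Qed.

Lemma sum_primeV_ge n : (1 < n)%N ->
  ln (lg n) - 20 <= \sum_(0 <= p < n.+1 | prime p) p%:R^-1.
Proof.
case: n => [|[|n]] // _; rewrite sum_primes_abel.
have l0 k : 0 < lg k.+2 by rewrite lg_gt0.
have H1 : 1 - 5 / lg n.+2 <= A n.+2 / lg n.+2.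
  rewrite ler_pdivlMr // mulrBl mul1r -mulrA mulVf ?gt_eqF // mulr1.
  exact: mertens_lower.
have H2 : ln (lg n.+2) - ln (lg 2) - 5 * ((lg 2)^-1 - (lg n.+2)^-1) 
      - 4 * (1 - n.+1%:R^-1) <= \sum_(2 <= k < n.+2) A k * dV k.
  elim: n {H1} => [|n IH]; first by rewrite big_geq // !subrr mulr0 invr1 !subrr mulr0 subr0.
  rewrite big_nat_recr //=; set S := \sum_(_ <= _ < _) _ in IH *.
  have := @mertens_lower R n.+2 isT; rewrite -/(A n.+2) => H.
  have D0 := @dV_ge0 n.+2 isT.
  have {}H := ler_wpM2r D0 H.
  have Q : ln (lg n.+3) - ln (lg n.+2) - 4 * (n.+1%:R^-1 - n.+2%:R^-1) <=
            lg n.+2 * dV n.+2.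
    have n1 : 1 <= n.+1%:R :> R by rewrite ler1n.
    have E : n.+2%:R = n.+1%:R + 1 :> R by rewrite -[n.+2]addn1 natrD.
    have d1 := @lgS_le R n.+2 isT.
    have e1 := @le_lg R _ _ (leqnSn n.+2).
    have v2 := @lg_ge_half R n.+2 isT.
    rewrite /dV -ln_div ?posrE //.
    have := @le_ln1Dx R (lg n.+3 / lg n.+2 - 1); rewrite (addrC 1) subrK => X.
    have {}X := X ltac:(by rewrite ltrBrDr addNr divr_gt0).
    apply: le_trans (lerB X (lexx _)) _.
    move: E d1 e1 v2 n1.
    set u := lg n.+3; set v := lg n.+2 => E; rewrite E.
    move: (n.+1%:R : R) => x uv vu v2 x1.
    have w : (x^-1 - (x + 1)^-1) = (x * (x + 1))^-1 by field; lra.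
    rewrite {}w.
    have xx : 0 < x * (x + 1) by apply: mulr_gt0; lra.
    have w : (u - v) * (x + 1) <= 1.
      have := ler_wpM2r (ltac:(lra) : 0 <= x + 1) uv; rewrite mulrDl mulVf; [|lra].
      by rewrite mulrBl; lra.
    have w2 : (u - v) ^+ 2 <= (x * (x + 1))^-1.
      rewrite -[_ ^-1]mul1r ler_pdivlMr //.
      have : ((u - v) * (x + 1)) ^+ 2 <= 1 by apply: exprn_ile1; [apply: mulr_ge0; lra|].
      have : 0 <= (u - v) ^+ 2 by apply: sqr_ge0.
      rewrite exprMn; move: ((u - v)^+2) => z z0; rewrite expr2 => Z.
      by nra.
    have -> : u / v - 1 = (u - v) / u + (u - v) ^+ 2 / (u * v) by field; apply/andP; split; lra.
    have -> : v * (v^-1 - u^-1) = (u - v) / u by field; apply/andP; split; lra.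
    have : (u - v) ^+ 2 / (u * v) <= 4 * (u - v) ^+ 2.
      rewrite ler_pdivrMr; last by apply: mulr_gt0; lra.
      have uv4 : 4^-1 <= u * v by nra.
      have z0 : 0 <= (u - v) ^+ 2 by apply: sqr_ge0.
      by have := ler_wpM2l z0 uv4; lra.
    by lra.
  move: H Q IH; rewrite mulrBl /dV; move: (n.+1%:R^-1) (n.+2%:R^-1) => a b *.
  by lra.
have q : (lg 2)^-1 <= 2.
  by rewrite -[2]invrK lef_pV2 ?posrE ?lg2_ge ?lg_gt0 //; lra.
have r : ln (lg 2) <= 0.
  by apply: ln_le0; apply: lg2_le1.
have s : 0 <= n.+1%:R^-1 :> R by rewrite invr_ge0.
move: H1 H2 q r s; rewrite !mulrBr; move: (n.+1%:R^-1) => a *.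
by lra.
Qed.

Lemma sum_primeV2_le n : \sum_(0 <= p < n.+1 | prime p) (p%:R ^+ 2)^-1 <= 4 :> R.
Proof.
apply: (@le_trans _ _ (2 * \sum_(0 <= p < n.+1 | prime p) lg p / p%:R ^+ 2)).
  rewrite mulr_sumr; apply: ler_sum => p pp; rewrite mulrA -{1}[_^-1]mul1r.
  apply: ler_wpM2r; first by rewrite invr_ge0 exprn_ge0.
  by have := lg_ge_half R (prime_gt1 pp); lra.
by have := sum_lg_div_sqr_le R n; lra.
Qed.

Lemma sum_split_primes (F : nat -> R) y0 y : (forall p, prime p -> 0 <= F p) ->
  \sum_(0 <= p < y.+1 | prime p && (y0 < p)%N) F p <= \sum_(0 <= p < y.+1 | prime p) F p
  /\ \sum_(0 <= p < y.+1 | prime p) F p <=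
     \sum_(0 <= p < y.+1 | prime p && (y0 < p)%N) F p + \sum_(0 <= p < y0.+1 | prime p) F p.
Proof.
move=> F0; rewrite (bigID (fun p => y0 < p)%N prime) /=.
split; first by rewrite lerDl sumr_ge0 // => p /andP[/F0].
rewrite lerD2l.
rewrite (big_nat_widen _ _ (maxn y y0).+1) ?ltnS ?leq_maxl //.
rewrite [X in _ <= X](big_nat_widen _ _ (maxn y y0).+1) ?ltnS ?leq_maxr //.
rewrite [X in X <= _]big_mkcond [X in _ <= X]big_mkcond; apply: ler_sum => p _.
case: ifP => [/andP[/andP[pp]]|_]; last by case: ifP => // /andP[/F0].
by rewrite -leqNgt -ltnS => -> _; rewrite pp.
Qed.

Lemma prod_gt0_ln (P : pred nat) (F : nat -> R) m n : (forall i, P i -> 0 < F i) ->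
  0 < \prod_(m <= i < n | P i) F i /\
  ln (\prod_(m <= i < n | P i) F i) = \sum_(m <= i < n | P i) ln (F i).
Proof.
move=> F0; rewrite -(big_filter _ P) -[in RHS]big_filter.
have : all P [seq i <- index_iota m n | P i] by apply: filter_all.
elim: [seq _ <- _ | _] => [|i s IH] /=; first by rewrite !big_nil ln1.
move=> /andP[Pi /IH[h1 h2]]; rewrite !big_cons mulr_gt0 ?F0 //; split=> //.
by rewrite lnM ?posrE ?F0 // h2.
Qed.

(* The hypothesis on [w] covers the Euler factors [wt] truncated at any exponent, uniformly. *)
Lemma euler_prod_bounds y0 : exists c C : R, [/\ 0 < c, 0 < C &
  forall (w : nat -> R) y, (1 < y)%N ->
    (forall p, prime p -> 1 + p%:R^-1 <= w p <= (1 - p%:R^-1)^-1) ->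
    c * lg y <= \prod_(0 <= p < y.+1 | prime p && (y0 < p)%N) w p <= C * lg y].
Proof.
pose S : R := \sum_(0 <= p < y0.+1 | prime p) p%:R^-1.
exists (expR (- 24 - S)), (expR 18); split; rewrite ?expR_gt0 // => w y y1 wb.
have x1 p : prime p -> 0 < (p%:R : R)^-1 <= 2^-1.
  move=> pp; have p2 : 2 <= p%:R :> R by rewrite ler_nat prime_gt1.
  by apply/andP; split; [rewrite invr_gt0; lra | rewrite lef_pV2 ?posrE //; lra].
have w0 p : prime p && (y0 < p)%N -> 0 < w p.
  by move=> /andP[pp _]; have := wb p pp; have := x1 p pp; lra.
have [W0 lnW] := prod_gt0_ln 0 y.+1 w0.
have ly : 0 < lg y by rewrite lg_gt0.
have E a : expR a * lg y = expR (a + ln (lg y)) by rewrite expRD lnK ?posrE.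
rewrite !E; move: W0; rewrite -lnK_eq => /eqP <-; rewrite !ler_expR lnW.
have V0 p : prime p -> 0 <= p%:R^-1 :> R by rewrite invr_ge0.
have [h1 h2] := sum_split_primes y0 y V0.
have h3 := sum_primeV_le y1; have h4 := sum_primeV_ge y1.
have h5 := sum_primeV2_le y.
have V2 p : prime p -> 0 <= (p%:R ^+ 2)^-1 :> R by rewrite invr_ge0 exprn_ge0.
have [h6 _] := sum_split_primes y0 y V2.
apply/andP; split.
  apply: (@le_trans _ _ (\sum_(0 <= p < y.+1 | prime p && (y0 < p)%N) (p%:R^-1 - (p%:R^+2)^-1))).
    by rewrite big_split /= sumrN; rewrite -/S in h2; lra.
  apply: ler_sum => p /andP[pp yp]; have := wb p pp; have := x1 p pp.
  rewrite -exprVn; move: (_ ^-1) => x xb wpb.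
  have := @ln_ge_subV R (w p) (w0 p ltac:(by rewrite pp)).
  have : (w p)^-1 <= (1 + x)^-1 by rewrite lef_pV2 ?posrE; lra.
  have : (1 + x)^-1 <= 1 - x + x ^+ 2.
    rewrite -[_^-1]mul1r ler_pdivrMr; last lra.
    rewrite expr2; have := mulr_ge0 (mulr_ge0 (ltac:(lra) : 0 <= x) (ltac:(lra) : 0 <= x)) (ltac:(lra) : 0 <= x).
    by move=> *; nra.
  by lra.
apply: (@le_trans _ _ (\sum_(0 <= p < y.+1 | prime p && (y0 < p)%N) (p%:R^-1 + 2 * (p%:R^+2)^-1))).
  apply: ler_sum => p /andP[pp yp]; have := wb p pp; have := x1 p pp.
  rewrite -exprVn; move: (_ ^-1) => x xb wpb.
  have d0 : 0 < 1 - x by lra.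
  have q : (1 - x)^-1 <= 1 + x + 2 * x ^+ 2.
    rewrite -[_^-1]mul1r ler_pdivrMr //.
    rewrite expr2; have := mulr_ge0 (mulr_ge0 (ltac:(lra) : 0 <= x) (ltac:(lra) : 0 <= x)) (ltac:(lra) : 0 <= 1 - 2 * x).
    by move=> *; nra.
  have := @le_ln1Dx R (w p - 1); rewrite (addrC 1) subrK => /(_ ltac:(lra)).
  by lra.
by rewrite big_split /= -mulr_sumr; lra.
Qed.

End PrimeProducts.

(** * Local factors *)

(* Instances: [lg], for the lower bound, and the logarithm of [Sf ustar], for the upper bound. *)
Record potential (R : realType) (phi : nat -> R) : Prop := Potential {
  potM : forall a b, coprime a b -> (0 < a)%N -> (0 < b)%N -> phi (a * b)%N = phi a + phi b;
  pot_ge : forall n, (0 < n)%N -> lg R n <= phi n;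
  pot_prime : forall p, prime p -> phi p = lg R p;
  pot_le : forall p k, prime p -> phi (p ^ k)%N <= 2 * k%:R * lg R p }.

Definition wt (R : realType) (K p : nat) : R := \sum_(0 <= k < K) p%:R^-1 ^+ k.

Definition lam (R : realType) (phi : nat -> R) (K p : nat) : R :=
  (\sum_(0 <= k < K) phi (p ^ k)%N * p%:R^-1 ^+ k) / wt R K p.

Definition Lam (R : realType) (phi : nat -> R) (K y0 y : nat) : R :=
  \sum_(0 <= p < y.+1 | prime p && (y0 < p)%N) lam phi K p.

Section LocalFactors.
Variable R : realType.
Local Notation lg := (lg R).
Local Notation wt := (wt R).

Lemma potential_lg : potential lg.
Proof.
split=> // [a b _ a0 b0|p k pp]; first exact: lgM.
rewrite lgX ?prime_gt0 //; apply: ler_wpM2r; first exact: lg_ge0.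
by rewrite ler_peMl // ler1n.
Qed.

Lemma pot1 phi : potential phi -> phi 1%N = 0 :> R.
Proof. by move=> H; have := potM H (coprime1n 1) isT isT; rewrite mul1n; lra. Qed.

Lemma pot_ge0 phi n : potential phi -> (0 < n)%N -> 0 <= phi n :> R.
Proof. by move=> H n0; apply: le_trans (lg_ge0 R n) (pot_ge H n0). Qed.

Lemma sum_sqr_geom_le (x : R) j K : 0 <= x <= 2^-1 ->
  \sum_(j <= k < K) k%:R ^+ 2 * x ^+ k <= 6 * 2 ^+ j * x ^+ j.
Proof.
move=> /andP[x0 x1].
have H : \sum_(0 <= k < K) k%:R ^+ 2 * 2^-1 ^+ k <= 6 :> R.
  suff -> : \sum_(0 <= k < K) k%:R ^+ 2 * 2^-1 ^+ k =
            6 - (2 * K%:R ^+ 2 + 4 * K%:R + 6) * 2^-1 ^+ K :> R.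
    rewrite gerBl mulr_ge0 ?exprn_ge0 ?invr_ge0 //.
    by rewrite !addr_ge0 ?mulr_ge0 ?exprn_ge0.
  elim: K => [|K IH]; first by rewrite big_geq // expr0; ring.
  by rewrite big_nat_recr //= IH [2^-1 ^+ K.+1]exprS -natr1; move: (2^-1 ^+ K) => z; field.
apply: (@le_trans _ _ (\sum_(j <= k < K) 2 ^+ j * x ^+ j * (k%:R ^+ 2 * 2^-1 ^+ k))).
  rewrite big_nat [X in _ <= X]big_nat; apply: ler_sum => k /andP[jk _].
  rewrite mulrCA; apply: ler_wpM2l; first exact: exprn_ge0.
  rewrite -{1}(subnKC jk) exprD [X in _ <= X]mulrAC [X in X <= _]mulrC.
  apply: ler_wpM2r; first exact: exprn_ge0.
  have -> : 2 ^+ j * 2^-1 ^+ k = 2^-1 ^+ (k - j) :> R.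
    rewrite -{1}(subnKC jk) exprD mulrA -exprMn divff ?pnatr_eq0 //.
    by rewrite expr1n mul1r.
  by apply: lerXn2r; rewrite ?nnegrE ?invr_ge0.
rewrite -mulr_sumr mulrC -mulrA; apply: ler_wpM2r.
  by rewrite mulr_ge0 // exprn_ge0.
have [Kj|jK] := leqP K j; first by rewrite big_geq.
apply: le_trans H; rewrite [X in _ <= X](@big_cat_nat _ _ _ j) //=; last exact: ltnW.
by rewrite lerDr sumr_ge0 // => k _; rewrite mulr_ge0 ?exprn_ge0 ?invr_ge0.
Qed.

Lemma prime_inv_bounds p : prime p -> 0 < (p%:R : R)^-1 <= 2^-1.
Proof.
move=> pp; have p2 : 2 <= p%:R :> R by rewrite ler_nat prime_gt1.
by apply/andP; split; [rewrite invr_gt0; lra | rewrite lef_pV2 ?posrE //; lra].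
Qed.

Lemma wt_bounds K p : (1 < K)%N -> prime p ->
  1 + p%:R^-1 <= wt K p <= (1 - p%:R^-1)^-1.
Proof.
move=> K1 /prime_inv_bounds; rewrite /wt; move: (_ ^-1) => x xb.
rewrite -(prednK (ltnW K1)) big_nat_recl // expr0.
apply/andP; split.
  rewrite lerD2l; case: K K1 => [|[|K]] //= _.
  rewrite big_nat_recl // expr1 lerDl sumr_ge0 // => k _; apply: exprn_ge0; lra.
have := @geom_sum_le R x K.-1 ltac:(lra) ltac:(lra); rewrite big_add1 /= => G.
have -> : (1 - x)^-1 = 1 + x / (1 - x) by field; lra.
by rewrite lerD2l.
Qed.

Lemma wt_ge1 K p : (1 < K)%N -> prime p -> 1 <= wt K p.
Proof. by move=> K1 pp; have := wt_bounds K1 pp; have := prime_inv_bounds pp; lra. Qed.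

Variables (phi : nat -> R) (K : nat).
Hypotheses (phiP : potential phi) (K1 : (1 < K)%N).

Lemma lam_bounds p : prime p ->
  lg p / p%:R - lg p / p%:R ^+ 2 <= lam phi K p <=
  lg p / p%:R + 48 * (lg p / p%:R ^+ 2).
Proof.
move=> pp; rewrite /lam; have := wt_bounds K1 pp; have := wt_ge1 K1 pp.
have := prime_inv_bounds pp; move: (wt K p) => w; rewrite -!exprVn.
have := @lg_ge0 R p.
have phiX k : 0 <= phi (p ^ k)%N by rewrite (pot_ge0 phiP) // expn_gt0 prime_gt0.
have phi_le k := @pot_le R phi phiP p k pp.
move: (_^-1) => x l0 xb w1 wb.
have E : \sum_(0 <= k < K) phi (p ^ k)%N * x ^+ k =
    lg p * x + \sum_(2 <= k < K) phi (p ^ k)%N * x ^+ k.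
  rewrite (@big_cat_nat _ _ _ 2) //=; congr (_ + _).
  by rewrite unlock /= expn0 expn1 (pot1 phiP) (pot_prime phiP pp) mul0r addr0 add0r expr1.
have S0 : 0 <= \sum_(2 <= k < K) phi (p ^ k)%N * x ^+ k.
  by rewrite sumr_ge0 // => k _; rewrite mulr_ge0 // exprn_ge0 //; lra.
have S1 : \sum_(2 <= k < K) phi (p ^ k)%N * x ^+ k <= 48 * (lg p * x ^+ 2).
  have := @sum_sqr_geom_le x 2 K ltac:(lra) => Q.
  apply: (@le_trans _ _ (\sum_(2 <= k < K) lg p * (k%:R ^+ 2 * x ^+ k))).
    rewrite big_nat [X in _ <= X]big_nat; apply: ler_sum => k /andP[k2 _].
    rewrite mulrA; apply: ler_wpM2r; first by apply: exprn_ge0; lra.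
    apply: le_trans (phi_le k) _; rewrite mulrC; apply: ler_wpM2l => //.
    by rewrite expr2 ler_wpM2r // ler_nat.
  rewrite -mulr_sumr; have := ler_wpM2l l0 Q; move/le_trans; apply.
  have : 0 <= lg p * x ^+ 2 by rewrite mulr_ge0 // exprn_ge0 //; lra.
  by lra.
rewrite E; move: (\sum_(_ <= _ < _) _) S0 S1 => S S0 S1.
have lx0 : 0 <= lg p * x by rewrite mulr_ge0 //; lra.
apply/andP; split; last first.
  rewrite ler_pdivrMr; last lra.
  have q0 : 0 <= 48 * (lg p * x ^+ 2) by rewrite !mulr_ge0 // ?exprn_ge0 //; lra.
  by have := ler_wpM2l (addr_ge0 lx0 q0) w1; lra.
rewrite ler_pdivlMr; last lra.
have -> : lg p * x - lg p * x ^+ 2 = lg p * x * (1 - x) by ring.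
have h : (1 - x) * w <= 1 by rewrite mulrC -ler_pdivlMr ?div1r; lra.
by have := ler_wpM2l lx0 h; lra.
Qed.

Lemma lam_ge0 p : prime p -> 0 <= lam phi K p.
Proof.
move=> pp; rewrite /lam divr_ge0 //; last by have := wt_ge1 K1 pp; lra.
rewrite sumr_ge0 // => k _; rewrite mulr_ge0 ?exprn_ge0 ?invr_ge0 //.
by rewrite (pot_ge0 phiP) // expn_gt0 prime_gt0.
Qed.

Lemma lam_le p : prime p -> lam phi K p <= 49.
Proof.
move=> pp; have := lam_bounds pp; rewrite -!exprVn => /andP[_ /le_trans]; apply.
have := prime_inv_bounds pp; have p0 : 0 < p%:R :> R by rewrite ltr0n prime_gt0.
have := lg_lt R (prime_gt0 pp) => l1 xb.
have : lg p / p%:R <= 1 by rewrite ler_pdivrMr //; lra.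
have : 0 <= lg p / p%:R by rewrite divr_ge0 ?lg_ge0 //; lra.
have -> : lg p * p%:R^-1 ^+ 2 = lg p / p%:R / p%:R by rewrite expr2 mulrA.
move: (lg p / _) => z z0 z1; move: (_^-1) xb => x xb.
by have := ler_wpM2l z0 (ltac:(lra) : x <= 1); lra.
Qed.

Lemma sqr_potential_mean_le p : prime p ->
  (\sum_(0 <= k < K) phi (p ^ k)%N ^+ 2 * p%:R^-1 ^+ k) / wt K p <=
  48 * (lg p ^+ 2 / p%:R).
Proof.
move=> pp; have := wt_ge1 K1 pp.
have := prime_inv_bounds pp; move: (wt K p) => w.
have := @lg_ge0 R p.
have phiX k : 0 <= phi (p ^ k)%N by rewrite (pot_ge0 phiP) // expn_gt0 prime_gt0.
have phi_le k := @pot_le R phi phiP p k pp.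
move: (_^-1) => x l0 xb w1.
have := @sum_sqr_geom_le x 1 K ltac:(lra) => Q.
have S1 : \sum_(0 <= k < K) phi (p ^ k)%N ^+ 2 * x ^+ k <= 48 * (lg p ^+ 2 * x).
  rewrite (@big_cat_nat _ _ _ 1) //=; last exact: ltnW.
  rewrite big_nat1 expn0 (pot1 phiP) expr0n mul0r add0r.
  apply: (@le_trans _ _ (\sum_(1 <= k < K) 4 * lg p ^+ 2 * (k%:R ^+ 2 * x ^+ k))).
    apply: ler_sum => k _.
    rewrite mulrA; apply: ler_wpM2r; first by apply: exprn_ge0; lra.
    apply: (@le_trans _ _ ((2 * k%:R * lg p) ^+ 2)).
      by rewrite lerXn2r // ?nnegrE // ?mulr_ge0.
    by rewrite le_eqVlt; apply/orP; left; apply/eqP; ring.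
  rewrite -mulr_sumr; have l4 : 0 <= 4 * lg p ^+ 2 by rewrite mulr_ge0 // exprn_ge0.
  have := ler_wpM2l l4 Q; move/le_trans; apply.
  by rewrite le_eqVlt; apply/orP; left; apply/eqP; ring.
rewrite ler_pdivrMr; last lra.
have q0 : 0 <= 48 * (lg p ^+ 2 * x) by rewrite !mulr_ge0 // ?exprn_ge0 //; lra.
by have := ler_wpM2l q0 w1; lra.
Qed.

End LocalFactors.

Lemma Lam_bounds (R : realType) (y0 : nat) : exists2 C : R, 0 < C &
  forall (phi : nat -> R) K y, potential phi -> (1 < K)%N -> (0 < y)%N ->
    lg R y - C <= Lam phi K y0 y <= lg R y + C.
Proof.
pose S : R := \sum_(0 <= p < y0.+1 | prime p) lg R p / p%:R.
have S0 : 0 <= S by rewrite sumr_ge0 // => p _; rewrite divr_ge0 // lg_ge0.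
exists (S + 98); first lra.
move=> phi K y phiP K1 y_gt0; rewrite /Lam.
have h0 p : prime p -> 0 <= lg R p / p%:R by rewrite divr_ge0 // lg_ge0.
have [h1 h2] := sum_split_primes y0 y h0.
have V0 p : prime p -> 0 <= lg R p / p%:R ^+ 2 by rewrite divr_ge0 ?exprn_ge0 // lg_ge0.
have [h3 _] := sum_split_primes y0 y V0.
have h4 := sum_lg_div_sqr_le R y.
have h5 := mertens_upper R y_gt0; have h6 := mertens_lower R y_gt0.
rewrite -/S in h2.
apply/andP; split.
  apply: (@le_trans _ _ (\sum_(0 <= p < y.+1 | prime p && (y0 < p)%N) 
      (lg R p / p%:R - lg R p / p%:R ^+ 2))).
    by rewrite big_split /= sumrN; lra.
  by apply: ler_sum => p /andP[pp _]; have /andP[] := lam_bounds phiP K1 pp.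
apply: (@le_trans _ _ (\sum_(0 <= p < y.+1 | prime p && (y0 < p)%N) 
      (lg R p / p%:R + 48 * (lg R p / p%:R ^+ 2)))).
  by apply: ler_sum => p /andP[pp _]; have /andP[] := lam_bounds phiP K1 pp.
by rewrite big_split /= -mulr_sumr; lra.
Qed.

(** * The stopped martingale *)

Section Sieve.
Variable R : realType.
Local Notation lg := (lg R).
Variables (phi : nat -> R) (K y0 m0 : nat) (c0 : R).
Hypotheses (phiP : potential phi) (K1 : (1 < K)%N) (m0_gt0 : (0 < m0)%N)
  (m0_smooth : forall p, prime p -> (p %| m0)%N -> (p <= y0)%N)
  (m0_ge : c0 - 49 <= phi m0).

Local Notation wt := (wt R K).
Local Notation lam := (lam phi K).
Local Notation Lam := (Lam phi K y0).

(* Exponents are truncated at [K] so that all sums are finite; every estimate is uniform in [K].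
   The number 49 below is the bound on [lam] from [lam_le]: it is the largest amount by which
   [phi - Lam] can undershoot the barrier [c0]. *)
Fixpoint survivors y : seq nat :=
  if y is y'.+1 then
    if prime y && (y0 < y)%N then
      [seq (m * y ^ k)%N | m <- [seq m <- survivors y' | Lam y' + c0 <= phi m],
                          k <- index_iota 0 K]
    else survivors y'
  else [:: m0].

Definition sieve_mass y : R := \prod_(0 <= p < y.+1 | prime p && (y0 < p)%N) wt p.

Lemma LamS y : Lam y.+1 = Lam y + (if prime y.+1 && (y0 < y.+1)%N then lam y.+1 else 0).
Proof. by rewrite /Lam big_mkcond big_nat_recr //= -big_mkcond. Qed.

Lemma sieve_massS y :
  sieve_mass y.+1 = sieve_mass y * (if prime y.+1 && (y0 < y.+1)%N then wt y.+1 else 1).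
Proof. by rewrite /sieve_mass big_mkcond big_nat_recr //= -big_mkcond. Qed.

Lemma Lam0 : Lam 0 = 0.
Proof. by rewrite /Lam big_mkcond big_nat1. Qed.

Lemma sieve_mass0 : sieve_mass 0 = 1.
Proof. by rewrite /sieve_mass big_mkcond big_nat1. Qed.

Lemma Lam_ge0 y : 0 <= Lam y.
Proof. by rewrite sumr_ge0 // => p /andP[pp _]; apply: lam_ge0. Qed.

Lemma sieve_mass_gt0 y : 0 < sieve_mass y.
Proof.
apply: (prod_gt0_ln 0 y.+1 _).1 => p /andP[pp _].
by have := wt_ge1 R K1 pp; lra.
Qed.

Lemma sum_survivorsS (F : nat -> R) y : prime y.+1 -> (y0 < y.+1)%N ->
  \sum_(m <- survivors y.+1) F m =
  \sum_(m <- survivors y | Lam y + c0 <= phi m) \sum_(0 <= k < K) F (m * y.+1 ^ k)%N.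
Proof.
by move=> pp yp; rewrite /survivors -/survivors pp yp /= big_allpairs_dep big_filter.
Qed.

Lemma survivors_smooth y m : m \in survivors y ->
  (0 < m)%N /\ (forall p, prime p -> (p %| m)%N -> (p <= maxn y y0)%N).
Proof.
clear phiP K1 m0_ge; elim: y m => [|y IH] m.
  by rewrite inE => /eqP ->; split=> // p pp /(m0_smooth pp); rewrite max0n.
rewrite /survivors -/survivors; case: ifP => [/andP[py yy]|_]; last first.
  move=> /IH[m_gt0 H]; split=> // p pp /(H p pp); lia.
case/allpairsP => -[a k] /= [+ _ ->]; rewrite mem_filter => /andP[_ /IH[a_gt0 H]].
split; first by rewrite muln_gt0 a_gt0 expn_gt0.
move=> p pp; rewrite Euclid_dvdM // => /orP[/(H p pp)|]; first lia.
by rewrite Euclid_dvdX // => /andP[/dvdn_leq -/(_ isT)]; lia.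
Qed.

Lemma survivors_gt0 y m : m \in survivors y -> (0 < m)%N.
Proof. by move/survivors_smooth => []. Qed.

Lemma survivors_coprime y m k : m \in survivors y -> prime y.+1 -> (y0 < y.+1)%N ->
  coprime m (y.+1 ^ k).
Proof.
clear phiP K1 m0_ge; move=> /survivors_smooth[_ H] py yy.
rewrite coprime_sym coprimeXl // prime_coprime //; apply/negP => /(H _ py); lia.
Qed.

Lemma phi_survivor y m k : m \in survivors y -> prime y.+1 -> (y0 < y.+1)%N ->
  phi (m * y.+1 ^ k)%N = phi m + phi (y.+1 ^ k)%N.
Proof.
move=> my py yy; apply: (potM phiP); first exact: survivors_coprime my py yy.
  exact: survivors_gt0 my.
by rewrite expn_gt0.
Qed.

Lemma survivors_uniq y : uniq (survivors y).
Proof.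
elim: y => [|y IH] //; rewrite /survivors -/survivors; case: ifP => // /andP[py yy].
apply: allpairs_uniq; rewrite ?filter_uniq ?iota_uniq //.
move=> [a i] [b j] /allpairsP[[a' i'] /= [+ _ [-> ->]]] /allpairsP[[b' j'] /= [+ _ [-> ->]]].
rewrite !mem_filter => /andP[_ ha] /andP[_ hb] E.
have V m k : m \in survivors y -> logn y.+1 (m * y.+1 ^ k) = k.
  move=> hm; rewrite lognM ?(survivors_gt0 hm) ?expn_gt0 // pfactorK //.
  have := survivors_coprime 1 hm py yy; rewrite expn1 coprime_sym => /logn_coprime ->.
  by rewrite add0n.
have ij : i' = j' by rewrite -(V a' i' ha) E V.
move: E; rewrite ij => /eqP; rewrite eqn_pmul2r ?expn_gt0 // => /eqP ->.
by [].
Qed.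

Lemma survivors_phi_ge y m : m \in survivors y -> Lam y + c0 - 49 <= phi m.
Proof.
elim: y m => [|y IH] m; first by rewrite inE Lam0 => /eqP ->; move: m0_ge; lra.
rewrite LamS /survivors -/survivors; case: ifP => [/andP[py yy]|_]; last by rewrite addr0; apply: IH.
case/allpairsP => -[a k] /= [+ _ ->]; rewrite mem_filter => /andP[alive ay].
rewrite phi_survivor //; have := lam_le phiP K1 py.
have := @pot_ge0 R phi (y.+1 ^ k) phiP; rewrite expn_gt0 => /(_ isT); lra.
Qed.

Lemma survivors_closed y m p : m \in survivors y -> prime p -> (y0 < p <= y)%N ->
  ~~ (p %| m)%N -> (m * p)%N \in survivors y.
Proof.
elim: y m => [|y IH] m; first by move=> _ _; case: p => [|p] /andP[].
rewrite /survivors -/survivors; case: ifP => [/andP[py yy]|npr] my pp /andP[yp py1] pm; last first.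
  apply: IH => //; rewrite yp /=; move: py1; rewrite leq_eqVlt => /orP[/eqP E|//].
  by rewrite -E pp yp in npr.
case/allpairsP: my pm => -[a k] /= [+ kK ->] pm; rewrite mem_filter => /andP[alive ay].
move: py1; rewrite leq_eqVlt => /orP[/eqP E|py1].
  have k0 : k = 0%N.
    case: k kK pm => // k kK; rewrite -E expnS mulnCA dvdn_mulr //.
  apply/allpairsP; exists (a, 1%N); rewrite /= mem_filter alive ay k0 expn0 muln1 expn1 E.
  by rewrite mem_index_iota.
apply/allpairsP; exists ((a * p)%N, k); split => //=; last by rewrite mulnAC.
have pa : ~~ (p %| a)%N by apply: contra pm => pa; rewrite dvdn_mulr.
have a_gt0 := survivors_gt0 ay.
have cpa : coprime a p by rewrite coprime_sym prime_coprime.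
rewrite mem_filter IH ?yp // andbT (potM phiP cpa a_gt0 (prime_gt0 pp)).
by have := @pot_ge0 R phi p phiP (prime_gt0 pp); lra.
Qed.

Lemma sum_wt p : \sum_(0 <= k < K) p%:R^-1 ^+ k = wt p. Proof. by []. Qed.

Lemma sum_lam p : prime p -> \sum_(0 <= k < K) phi (p ^ k)%N * p%:R^-1 ^+ k = lam p * wt p.
Proof.
by move=> pp; rewrite /lam mulfVK // gt_eqF //; have := wt_ge1 R K1 pp; lra.
Qed.

Lemma natrMX_inv (m p k : nat) : (m * p ^ k)%:R^-1 = m%:R^-1 * p%:R^-1 ^+ k :> R.
Proof. by rewrite natrM natrX invfM exprVn. Qed.

(* The mean of [phi (p ^ k)] over [k] is [lam p], so [phi - Lam] is a martingale. *)
Lemma sum_survivorsS_martingale (a : R) y : prime y.+1 -> (y0 < y.+1)%N ->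
  \sum_(m <- survivors y.+1) (phi m - Lam y.+1 + a) / m%:R =
  wt y.+1 * \sum_(m <- survivors y | Lam y + c0 <= phi m) (phi m - Lam y + a) / m%:R.
Proof.
move=> py yy; rewrite sum_survivorsS // mulr_sumr.
rewrite big_seq_cond [RHS]big_seq_cond; apply: eq_bigr => m /andP[my _].
rewrite LamS py yy /=.
under eq_bigr => k _.
  rewrite phi_survivor // natrMX_inv.
  have -> : (phi m + phi (y.+1 ^ k)%N - (Lam y + lam y.+1) + a) *
     (m%:R^-1 * y.+1%:R^-1 ^+ k) = (phi m - (Lam y + lam y.+1) + a) / m%:R * y.+1%:R^-1 ^+ k +
      m%:R^-1 * (phi (y.+1 ^ k)%N * y.+1%:R^-1 ^+ k) by ring.
  over.
by rewrite big_split /= -!mulr_sumr sum_wt sum_lam //; ring.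
Qed.

Lemma sum_survivorsS_inv y : prime y.+1 -> (y0 < y.+1)%N ->
  \sum_(m <- survivors y.+1) m%:R^-1 =
  wt y.+1 * \sum_(m <- survivors y | Lam y + c0 <= phi m) m%:R^-1.
Proof.
move=> py yy; rewrite sum_survivorsS // mulr_sumr; apply: eq_bigr => m _.
under eq_bigr => k _ do rewrite natrMX_inv.
by rewrite -mulr_sumr sum_wt mulrC.
Qed.

Lemma sum_survivors_inv_le y : \sum_(m <- survivors y) m%:R^-1 <= sieve_mass y.
Proof.
elim: y => [|y IH].
  by rewrite big_seq1 sieve_mass0 invf_le1 ?ltr0n // ler1n.
rewrite sieve_massS; case: ifP => [/andP[py yy]|npr]; last first.
  by rewrite mulr1 /survivors -/survivors npr.
rewrite sum_survivorsS_inv // mulrC; apply: ler_wpM2r; first by have := wt_ge1 R K1 py; lra.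
apply: le_trans IH; rewrite [X in X <= _]big_mkcond /=; apply: ler_sum => m _.
by case: ifP => // _; rewrite invr_ge0.
Qed.

Lemma first_moment_le y :
  \sum_(m <- survivors y) (phi m - Lam y + (49 - c0)) / m%:R <=
    (phi m0 + (49 - c0)) * sieve_mass y.
Proof.
have m01 : 1 <= m0%:R :> R by rewrite ler1n.
elim: y => [|y IH].
  rewrite big_seq1 sieve_mass0 Lam0 subr0 mulr1 ler_pdivrMr; last lra.
  by rewrite ler_peMr //; move: m0_ge; lra.
rewrite sieve_massS; case: ifP => [prS|npr]; last first.
  by rewrite mulr1 /survivors -/survivors npr LamS npr addr0.
have /andP[py yy] := prS; rewrite sum_survivorsS_martingale // mulrA mulrC.
apply: ler_wpM2r; first by have := wt_ge1 R K1 py; lra.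
apply: le_trans IH; rewrite [X in X <= _]big_mkcond /= big_seq [X in _ <= X]big_seq.
apply: ler_sum => m my; case: ifP => // _.
by rewrite divr_ge0 //; have := survivors_phi_ge my; lra.
Qed.

Lemma first_moment_ge y :
  (phi m0 - c0) / m0%:R * sieve_mass y <=
  \sum_(m <- survivors y) (phi m - Lam y - c0) / m%:R.
Proof.
elim: y => [|y IH]; first by rewrite big_seq1 sieve_mass0 Lam0 subr0 mulr1.
rewrite sieve_massS; case: ifP => [prS|npr]; last first.
  by rewrite mulr1 /survivors -/survivors npr LamS npr addr0.
have /andP[py yy] := prS; rewrite sum_survivorsS_martingale // mulrA [X in _ <= X]mulrC.
apply: ler_wpM2r; first by have := wt_ge1 R K1 py; lra.
apply: le_trans IH _; rewrite [X in _ <= X]big_mkcond /=.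
apply: ler_sum => m _; case: ifP => // /negbT; rewrite -ltNge => dead.
by rewrite mulr_le0_ge0 ?invr_ge0 //; lra.
Qed.

Lemma second_momentS y : prime y.+1 -> (y0 < y.+1)%N ->
  \sum_(m <- survivors y.+1) (phi m - Lam y.+1) ^+ 2 / m%:R <=
  wt y.+1 * (\sum_(m <- survivors y) (phi m - Lam y) ^+ 2 / m%:R +
   48 * (lg y.+1 ^+ 2 / y.+1%:R) * \sum_(m <- survivors y) m%:R^-1).
Proof.
move=> py yy; have w1 := wt_ge1 R K1 py; have := sqr_potential_mean_le phiP K1 py.
set q := 48 * _; rewrite ler_pdivrMr; last lra; move=> Hq.
have q0 : 0 <= q by rewrite /q !mulr_ge0 ?exprn_ge0 ?invr_ge0 ?lg_ge0.
rewrite sum_survivorsS // mulr_sumr -big_split /= mulr_sumr.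
rewrite [X in X <= _]big_mkcond /= big_seq [X in _ <= X]big_seq.
apply: ler_sum => m my.
have mV0 : 0 <= m%:R^-1 :> R by rewrite invr_ge0.
case: ifP => _; last first.
  by apply: mulr_ge0; [lra | apply: addr_ge0; apply: mulr_ge0; rewrite ?sqr_ge0].
rewrite LamS py yy /=.
under eq_bigr => k _.
  rewrite phi_survivor // natrMX_inv.
  have -> : (phi m + phi (y.+1 ^ k)%N - (Lam y + lam y.+1)) ^+ 2 *
     (m%:R^-1 * y.+1%:R^-1 ^+ k) = 
      (phi m - Lam y - lam y.+1) ^+ 2 / m%:R * y.+1%:R^-1 ^+ k +
      2 * (phi m - Lam y - lam y.+1) / m%:R * (phi (y.+1 ^ k)%N * y.+1%:R^-1 ^+ k) +
      m%:R^-1 * (phi (y.+1 ^ k)%N ^+ 2 * y.+1%:R^-1 ^+ k) by ring.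
  over.
rewrite !big_split /= -!mulr_sumr sum_wt sum_lam //.
have {}Hq := ler_wpM2l mV0 Hq.
apply: le_trans (lerD (lexx _) Hq) _.
rewrite -subr_ge0 [X in 0 <= X](_ : _ = lam y.+1 ^+ 2 * wt y.+1 / m%:R); last by ring.
apply: mulr_ge0 => //; apply: mulr_ge0; rewrite ?sqr_ge0 //; lra.
Qed.

End Sieve.

(** * Moments of the survivors *)

Lemma root_nat k y : (0 < k)%N -> exists s, (s ^ k <= y < s.+1 ^ k)%N.
Proof.
move=> k0; elim: y => [|y [s /andP[h1 h2]]].
  by exists 0%N; rewrite exp0n // exp1n.
have [h|h] := ltnP y.+1 (s.+1 ^ k); first by exists s; rewrite h andbT leqW.
by exists s.+1; rewrite h /=; apply: leq_ltn_trans h2 _; rewrite ltn_exp2r.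
Qed.

Section Moments.
Variable R : realType.
Local Notation lg := (lg R).

Lemma lg_unbounded (a : R) : exists n, forall m, (n <= m)%N -> a <= lg m.
Proof.
exists (2 ^ Num.bound (2 * a))%N => m nm.
apply: le_trans (le_lg R nm); rewrite lgX //.
have [a0|a0] := leP a 0.
  by apply: le_trans a0 _; rewrite mulr_ge0 // lg_ge0.
have a2 : 0 <= 2 * a by lra.
have := archi_boundP a2 => h; have := lg2_ge R => h2.
have : 2 * a * 2^-1 <= (Num.bound (2 * a))%:R * lg 2.
  by apply: ler_pM => //; lra.
by lra.
Qed.

Lemma half_lg_le y p : (0 < y)%N -> (y < p ^ 2)%N -> lg y / 2 <= lg p.
Proof.
move=> y0 yp; have p0 : (0 < p)%N by case: p yp.
by have := le_lg R (ltnW yp); rewrite lgX //; lra.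
Qed.

Lemma sum_primeV_sqrt_ge y0 : exists y1, forall y, (y1 <= y)%N ->
  4^-1 <= \sum_(0 <= p < y.+1 | [&& prime p, y0 < p & y < p ^ 2]%N) (p%:R : R)^-1.
Proof.
have [n Hn] := lg_unbounded 28; exists (n + y0.+1 ^ 2)%N => y ny.
have ly := Hn y ltac:(lia).
have [s /andP[s1 s2]] := root_nat y (isT : 0 < 2)%N.
have y_gt0 : (0 < y)%N by apply: leq_trans ny; rewrite addn_gt0 expn_gt0 orbT.
have ys : (y0 <= s)%N by rewrite -ltnS -(@ltn_exp2r _ _ 2) //; lia.
have s_gt0 : (0 < s)%N by case: (s) s2 => //; rewrite exp1n; lia.
have F0 p : prime p -> 0 <= lg p / p%:R by rewrite divr_ge0 // lg_ge0.
have [_ h] := sum_split_primes s y F0.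
have h1 := mertens_lower R y_gt0; have h2 := mertens_upper R s_gt0.
have h3 := le_lg R s1; rewrite lgX // in h3.
have ly0 : 0 < lg y by lra.
rewrite -(ler_pM2r ly0) mulr_suml.
apply: (@le_trans _ _ (\sum_(0 <= p < y.+1 | prime p && (s < p)%N) lg p / p%:R)); first lra.
rewrite big_nat_cond [X in _ <= X]big_nat_cond big_mkcond [X in _ <= X]big_mkcond /=.
apply: ler_sum => p _; rewrite ltnS; case: ifP => [/andP[py /andP[pp sp]]|_]; last first.
  by case: ifP => // _; rewrite mulr_ge0 ?invr_ge0 ?lg_ge0.
rewrite py pp (leq_ltn_trans ys sp) (leq_trans s2) ?leq_exp2r //=.
by rewrite mulrC; apply: ler_wpM2l; rewrite ?invr_ge0 // le_lg.
Qed.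

Definition large_primes (y0 y : nat) : pred nat :=
  fun p => [&& prime p, y0 < p & y < p ^ 2]%N.

Lemma count_large_primes_le y0 y N : (0 < y)%N -> (0 < N)%N ->
  (\sum_(0 <= p < y.+1 | large_primes y0 y p && (p %| N)%N) 1) * (lg y / 2) <= lg N.
Proof.
move=> y_gt0 N0; rewrite mulr_suml.
apply: (@le_trans _ _ (\sum_(0 <= p < y.+1 | large_primes y0 y p && (p %| N)%N) lg p)).
  by apply: ler_sum => p /andP[/and3P[_ _ yp] _]; rewrite mul1r half_lg_le.
rewrite -lg_prod; last by move=> p /andP[/and3P[/prime_gt0]].
by apply/le_lg/prod_primes_le => // p _ /andP[/and3P[]].
Qed.

Lemma ler_sum_sub (T : eqType) (s1 s2 : seq T) (P1 P2 : pred T) (F : T -> R) :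
  uniq s1 -> uniq s2 -> (forall x, x \in s1 -> P1 x -> (x \in s2) && P2 x) ->
  (forall x, x \in s2 -> P2 x -> 0 <= F x) ->
  \sum_(x <- s1 | P1 x) F x <= \sum_(x <- s2 | P2 x) F x.
Proof.
move=> u1 u2 sub F0; rewrite -[X in X <= _]big_filter -[X in _ <= X]big_filter.
rewrite [X in _ <= X](bigID (mem (filter P1 s1)) predT) /=.
rewrite -[X in _ <= X + _]big_filter.
have -> : \sum_(i <- [seq i <- [seq x <- s2 | P2 x] | i \in [seq x <- s1 | P1 x]]) F i =
   \sum_(i <- [seq x <- s1 | P1 x]) F i.
  apply: perm_big; apply: uniq_perm; rewrite ?filter_uniq // => x.
  rewrite !mem_filter; case: (boolP (P1 x)) => //= p1; case: (boolP (x \in s1)) => //= x1.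
  by have /andP[-> ->] := sub x x1 p1.
rewrite lerDl big_seq_cond sumr_ge0 // => x; rewrite mem_filter => /andP[/andP[p2 x2] _].
exact: F0.
Qed.

(* Multiplying survivors by a large prime [p <= y] moves [phi - Lam] away from the barrier, where
   [first_moment_le] is effective; a survivor arises from few such multiplications. *)
Lemma sum_survivors_inv_bounded y0 m0 (c0 b0 : R) : (0 < m0)%N ->
  (forall p, prime p -> (p %| m0)%N -> (p <= y0)%N) ->
  exists2 D : R, 0 < D & forall phi K, potential phi -> (1 < K)%N -> c0 - 49 <= phi m0 ->
    phi m0 <= b0 -> forall y, (1 < y)%N ->
    \sum_(m <- survivors phi K y0 m0 c0 y) m%:R^-1 <= D.
Proof.
move=> m0_gt0 m0_smooth.
have [c [C [c_gt0 C_gt0 HW]]] := euler_prod_bounds R y0.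
have [C3 C3_gt0 HL] := Lam_bounds R y0.
have [y1 Hy1] := sum_primeV_sqrt_ge y0.
have [y2 Hy2] := lg_unbounded (C3 + `|c0| + 49).
pose Y := (y1 + y2 + 32 ^ 2)%N; pose v := `|b0| + 49 + `|c0|.
have v_gt0 : 0 < v by rewrite /v; have := normr_ge0 b0; have := normr_ge0 c0; lra.
exists (82 * v * C + C * lg Y).
  by rewrite ltr_wpDr ?mulr_gt0 // mulr_ge0 ?lg_ge0 // ltW.
move=> phi K phiP K1 m0_ge m0_le y y_gt1.
have W_le : sieve_mass R K y0 y <= C * lg y.
  by have /andP[] := HW (wt R K) y y_gt1 (fun p pp => wt_bounds R K1 pp).
have [yY|Yy] := leqP y Y.
  apply: le_trans (sum_survivors_inv_le _ _ _ _ _ _) _ => //; apply: le_trans W_le _.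
  apply: (@le_trans _ _ (C * lg Y)); first by apply: ler_wpM2l; [exact: ltW|exact: le_lg].
  by rewrite lerDr !mulr_ge0 // ltW.
have ly0 : 0 < lg y by rewrite lg_gt0.
have y2y : (y2 <= y)%N.
  by apply: leq_trans (ltnW Yy); rewrite /Y addnAC leq_addl.
have ly1 := Hy2 y y2y.
have y1y : (y1 <= y)%N by apply: leq_trans (ltnW Yy); rewrite /Y -addnA leq_addr.
have hQ := Hy1 y y1y.
have V_le := first_moment_le phiP K1 m0_gt0 m0_smooth m0_ge y.
have L_le := HL phi K y phiP K1 (ltnW y_gt1).
have smooth := @survivors_smooth R phi K y0 m0 c0 m0_gt0 m0_smooth y.
have phi_ge := @survivors_phi_ge R phi K y0 m0 c0 phiP K1 m0_gt0 m0_smooth m0_ge y.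
have closed := @survivors_closed R phi K y0 m0 c0 phiP K1 m0_gt0 m0_smooth y.
have unq := @survivors_uniq R phi K y0 m0 c0 m0_gt0 m0_smooth y.
set A := survivors phi K y0 m0 c0 y in smooth phi_ge closed unq V_le *.
set L := Lam phi K y0 y in L_le V_le phi_ge *.
pose t m : R := phi m - L + (49 - c0).
have t_ge0 m : m \in A -> 0 <= t m by move=> /phi_ge; rewrite /t; lra.
set V : R := \sum_(m <- A) _ in V_le.
have {}V_le : V <= v * C * lg y.
  apply: le_trans V_le _; rewrite -mulrA.
  apply: (@le_trans _ _ (v * sieve_mass R K y0 y)); last by apply: ler_wpM2l => //; exact: ltW.
  apply: ler_wpM2r; first by apply/ltW/sieve_mass_gt0.
  by rewrite /v; have := ler_norm b0; have := ler_norm (- c0); rewrite normrN; lra.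
have phi_le m : phi m <= t m + 2 * lg y.
  by rewrite /t; have := ler_norm c0; have := normr_ge0 c0; lra.
pose w N : R := \sum_(0 <= p < y.+1 | large_primes y0 y p && (p %| N)%N) 1.
have w_ge0 N : 0 <= w N by rewrite sumr_ge0.
have w_le N : N \in A -> w N * lg y <= 2 * (t N + 2 * lg y).
  move=> NA; have [N0 _] := smooth N NA.
  have := count_large_primes_le y0 (ltnW y_gt1) N0; rewrite -/(w N).
  by have := phi_le N; have := pot_ge phiP N0; lra.
set S := \sum_(m <- A) _.
have S_ge0 : 0 <= S by rewrite sumr_ge0 // => m _; rewrite invr_ge0.
have lhs : 4^-1 * S - \sum_(m <- A) m%:R^-1 * (32^-1 * w m) <=
  \sum_(m <- A) \sum_(0 <= p < y.+1 | large_primes y0 y p && ~~ (p %| m)%N) (m * p)%:R^-1.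
  rewrite mulr_sumr -sumrB big_seq [X in _ <= X]big_seq; apply: ler_sum => m mA.
  rewrite mulrC -mulrBr.
  have mV0 : 0 <= m%:R^-1 :> R by rewrite invr_ge0.
  under [X in _ <= X]eq_bigr => p _ do rewrite natrM invfM.
  rewrite -mulr_sumr; apply: ler_wpM2l => //.
  move: hQ; rewrite (bigID (fun p => p %| m)%N) /= => hQ.
  suff : \sum_(0 <= p < y.+1 | large_primes y0 y p && (p %| m)%N) (p%:R : R)^-1 <= 32^-1 * w m.
    by move: hQ; rewrite /large_primes; lra.
  rewrite /w mulr_sumr; apply: ler_sum => p /andP[/and3P[pp _ yp] _].
  rewrite mulr1 lef_pV2 ?ler_nat ?posrE ?ltr0n ?(prime_gt0 pp) //.
  have Yp : (32 ^ 2 < p ^ 2)%N.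
    by apply: leq_ltn_trans yp; apply: leq_trans (ltnW Yy); apply: leq_addl.
  by move: Yp; rewrite ltn_exp2r // => /ltnW.
have rhs : \sum_(m <- A) \sum_(0 <= p < y.+1 | large_primes y0 y p && ~~ (p %| m)%N) (m * p)%:R^-1 <=
  \sum_(N <- A | lg y / 2 <= t N) N%:R^-1 * w N.
  rewrite (exchange_big_dep (large_primes y0 y)) /=; last by move=> ? ? _ /andP[].
  under [X in _ <= X]eq_bigr => N _ do rewrite /w mulr_sumr.
  rewrite [X in _ <= X](exchange_big_dep (large_primes y0 y)) /=; last by move=> ? ? _ /andP[].
  rewrite big_nat_cond [X in _ <= X]big_nat_cond; apply: ler_sum => p /andP[/andP[_ py] lp].
  rewrite lp /=; have /and3P[pp yp yp2] := lp.
  under [X in _ <= X]eq_bigr => N _ do rewrite mulr1.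
  rewrite -big_filter -(big_map (muln^~ p) predT (fun N => N%:R^-1)).
  have p0 := prime_gt0 pp.
  apply: ler_sum_sub => //.
  - by rewrite map_inj_uniq ?filter_uniq // => a b /eqP; rewrite eqn_pmul2r // => /eqP.
  - move=> x /mapP[m]; rewrite mem_filter => /andP[pm mA ->] _.
    rewrite closed ?yp //= dvdn_mull // andbT.
    have [m_gt0 _] := smooth m mA.
    have cmp : coprime m p by rewrite coprime_sym prime_coprime.
    have := t_ge0 m mA; rewrite /t (potM phiP cmp m_gt0 p0) (pot_prime phiP pp).
    by have := half_lg_le (ltnW y_gt1) yp2; lra.
  - by move=> x _ _; rewrite invr_ge0.
have w_sum : (\sum_(m <- A) m%:R^-1 * (32^-1 * w m)) * lg y <= 16^-1 * V + 8^-1 * (lg y * S).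
  rewrite mulr_suml !mulr_sumr -big_split /= big_seq [X in _ <= X]big_seq.
  apply: ler_sum => m mA; have mV0 : 0 <= m%:R^-1 :> R by rewrite invr_ge0.
  have := ler_wpM2l mV0 (w_le m mA); rewrite -/(t m).
  by move: (t m) (w m) (m%:R^-1) (lg y) => *; lra.
have w_sum2 : (\sum_(N <- A | lg y / 2 <= t N) N%:R^-1 * w N) * lg y <= 10 * V.
  rewrite mulr_suml mulr_sumr big_mkcond big_seq [X in _ <= X]big_seq.
  apply: ler_sum => m mA; have mV0 : 0 <= m%:R^-1 :> R by rewrite invr_ge0.
  rewrite -/(t m); case: ifP => [h|_]; last by rewrite !mulr_ge0 ?t_ge0.
  have := ler_wpM2l mV0 (w_le m mA).
  have := ler_wpM2l mV0 h.
  by move: (t m) (w m) (m%:R^-1) (lg y) => *; lra.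
have := ler_wpM2r (ltW ly0) (le_trans lhs rhs).
rewrite mulrBl => main.
have vCl : 0 <= v * C * lg y by rewrite !mulr_ge0 // ltW.
have : S * lg y <= 82 * v * C * lg y by lra.
rewrite ler_pM2r // => /le_trans; apply.
by rewrite lerDl mulr_ge0 ?lg_ge0 // ltW.
Qed.
End Moments.

(* The martingale [phi - Lam] has quadratic variation [sum (ln p)^2 / p] weighted by the survival
   probability, which is of order [1 / ln p] by [sum_survivors_inv_bounded]. *)
Lemma survivors_moments (R : realType) y0 m0 (c0 b0 : R) : (0 < m0)%N ->
  (forall p, prime p -> (p %| m0)%N -> (p <= y0)%N) ->
  exists2 D : R, 0 < D & forall phi K, potential phi -> (1 < K)%N -> c0 - 49 <= phi m0 ->
    phi m0 <= b0 -> forall y, (1 < y)%N ->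
    \sum_(m <- survivors phi K y0 m0 c0 y) m%:R^-1 <= D /\
    \sum_(m <- survivors phi K y0 m0 c0 y) phi m ^+ 2 / m%:R <= D * lg R y ^+ 2.
Proof.
move=> m0_gt0 m0_smooth.
have [c [C [c_gt0 C_gt0 HW]]] := euler_prod_bounds R y0.
have [C3 C3_gt0 HL] := Lam_bounds R y0.
have [D1 D1_gt0 HS] := sum_survivors_inv_bounded c0 b0 m0_gt0 m0_smooth.
pose E := 2 * D1 / c + 1.
have E1 : 1 <= E by rewrite lerDr !mulr_ge0 ?invr_ge0 // ltW.
pose D2 : R := 2 * (C * (2 * b0 ^+ 2 + 240 * E)) + 2 * ((1 + 2 * C3) ^+ 2 * D1).
have D2_ge0 : 0 <= D2.
  have b2 := sqr_ge0 b0; have c2 := sqr_ge0 (1 + 2 * C3).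
  apply: addr_ge0; apply: mulr_ge0 => //; apply: mulr_ge0 => //; lra.
exists (D1 + D2); first lra.
move=> phi K phiP K1 m0_ge m0_le y y_gt1.
have {}HS := HS phi K phiP K1 m0_ge m0_le.
split; first by have := HS y y_gt1; lra.
pose W y := sieve_mass R K y0 y; pose S y := \sum_(m <- survivors phi K y0 m0 c0 y) m%:R^-1 : R.
have W_gt0 z : 0 < W z by apply: sieve_mass_gt0.
have HWy z : (1 < z)%N -> c * lg R z <= W z <= C * lg R z.
  by move=> z1; exact: (HW (wt R K) z z1 (fun p pp => wt_bounds R K1 pp)).
have S_le z : (0 < z)%N -> S z * lg R z.+1 <= E * W z.
  move=> z0; have S0 : 0 <= S z by rewrite sumr_ge0 // => m _; rewrite invr_ge0.
  have [z1|z1] := leqP z 1.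
    have -> : z = 1%N by lia.
    have := @sum_survivors_inv_le R phi K y0 m0 c0 K1 m0_gt0 1; rewrite -/(S 1) -/(W 1) => h.
    have := lg2_le1 R; have := lg_ge0 R 2; have := W_gt0 1%N => w l0 l1.
    have e := ler_wpM2r (ltW w) E1; have f := ler_wpM2r l0 h.
    by have := ler_wpM2l (ltW w) l1; lra.
  have lz : lg R z.+1 <= 2 * lg R z.
    by rewrite -[2 * _](lgX R 2 z0); apply: le_lg; nia.
  have /andP[w1 _] := HWy z z1; have h := HS z z1; rewrite -/(S z) in h.
  have l0 := lg_gt0 R z1.
  have e1 : S z * lg R z.+1 <= D1 * (2 * lg R z) by apply: ler_pM => //; exact: lg_ge0.
  have e2 : D1 * (2 * lg R z) <= 2 * D1 / c * W z.
    have -> : D1 * (2 * lg R z) = 2 * D1 / c * (c * lg R z) by field; lra.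
    by apply: ler_wpM2l => //; rewrite !mulr_ge0 ?invr_ge0 // ltW.
  by have := W_gt0 z; rewrite /E; lra.
pose M z : R := \sum_(0 <= p < z.+1 | prime p) lg R p / p%:R.
have MS z : M z.+1 = M z + (if prime z.+1 then lg R z.+1 / z.+1%:R else 0).
  by rewrite /M big_mkcond big_nat_recr //= -big_mkcond.
have Q_le z : \sum_(m <- survivors phi K y0 m0 c0 z) (phi m - Lam phi K y0 z) ^+ 2 / m%:R <=
    W z * (b0 ^+ 2 + 48 * E * M z).
  elim: z => [|z IH].
    rewrite big_seq1 /W sieve_mass0 Lam0 subr0 mul1r /M [X in _ + _ * X]big_mkcond big_nat1 /=.
    have f0 := pot_ge0 phiP m0_gt0.
    have ff : phi m0 ^+ 2 <= b0 ^+ 2 by rewrite lerXn2r ?nnegrE //; lra.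
    have : phi m0 ^+ 2 / m0%:R <= phi m0 ^+ 2.
      by rewrite ler_pdivrMr ?ltr0n // ler_peMr ?sqr_ge0 // ler1n.
    lra.
  have lz : 0 <= lg R z.+1 / z.+1%:R by rewrite divr_ge0 ?lg_ge0.
  rewrite MS /W sieve_massS -/(W z); case: (boolP (prime z.+1 && _)) => [/andP[pz yz]|npr]; last first.
    rewrite /survivors -/survivors (negbTE npr) LamS (negbTE npr) addr0 mulr1.
    apply: le_trans IH _; apply: ler_wpM2l; first exact: ltW.
    rewrite lerD2l; apply: ler_wpM2l; first by lra.
    by case: ifP => _; rewrite ?addr0 // lerDl.
  rewrite pz; apply: le_trans (second_momentS c0 phiP K1 m0_gt0 m0_smooth pz yz) _.
  have w1 := wt_ge1 R K1 pz.
  rewrite [X in _ <= X](_ : _ = wt R K z.+1 * (W z * (b0 ^+ 2 + 48 * E * M z) +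
     48 * (lg R z.+1 / z.+1%:R) * (E * W z))); last by ring.
  apply: ler_wpM2l; first by lra.
  apply: lerD => //; rewrite -/(S z).
  have -> : 48 * (lg R z.+1 ^+ 2 / z.+1%:R) * S z =
    48 * (lg R z.+1 / z.+1%:R) * (S z * lg R z.+1) by ring.
  by apply: ler_wpM2l; [rewrite mulr_ge0|apply: S_le; move: pz; case: (z)].
have ly := lg_ge_half R y_gt1.
have /andP[_ w2] := HWy y y_gt1.
have := HS y y_gt1; have := Q_le y; have := mertens_upper R (ltnW y_gt1); rewrite -/(M y).
have /andP[_ Lu] := HL phi K y phiP K1 (ltnW y_gt1).
have L0 := Lam_ge0 y0 phiP K1 y.
move: (Lam phi K y0 y) Lu L0 => L Lu L0 HM.
set A := survivors _ _ _ _ _ _; set Q := \sum_(m <- A) _; set T := \sum_(m <- A) _ => HQ HT.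
have T0 : 0 <= T by rewrite sumr_ge0 // => m _; rewrite invr_ge0.
have Q2 : Q <= C * (2 * b0 ^+ 2 + 240 * E) * lg R y ^+ 2.
  apply: le_trans HQ _.
  have b2 := sqr_ge0 b0.
  have M0 : 0 <= M y by rewrite sumr_ge0 // => p _; rewrite divr_ge0 ?lg_ge0.
  have EM : 0 <= E * M y by rewrite mulr_ge0 //; lra.
  rewrite [X in _ <= X](_ : _ = C * lg R y * ((2 * b0 ^+ 2 + 240 * E) * lg R y)); last by ring.
  apply: ler_pM => //; [exact: ltW|lra|].
  have e1 : E * M y <= E * (5 * lg R y) by apply: ler_wpM2l; lra.
  have e2 := ler_wpM2l b2 ly.
  by lra.
have L2 : L ^+ 2 <= ((1 + 2 * C3) * lg R y) ^+ 2.
  rewrite lerXn2r ?nnegrE //; first by rewrite mulr_ge0 //; lra.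
  by have := ler_wpM2l (ltW C3_gt0) ly; lra.
have T2 : L ^+ 2 * T <= ((1 + 2 * C3) * lg R y) ^+ 2 * D1.
  by apply: ler_pM => //; exact: sqr_ge0.
apply: (@le_trans _ _ (2 * Q + 2 * (L ^+ 2 * T))).
  rewrite mulrA !mulr_sumr -big_split /=; apply: ler_sum => m _.
  have -> : 2 * ((phi m - L) ^+ 2 / m%:R) + 2 * L ^+ 2 / m%:R =
     phi m ^+ 2 / m%:R + (phi m - 2 * L) ^+ 2 / m%:R by ring.
  by rewrite lerDl divr_ge0 // sqr_ge0.
have := mulr_ge0 (ltW D1_gt0) (sqr_ge0 (lg R y)).
by rewrite exprMn in T2; rewrite /D2; lra.
Qed.

(** * The unitary totient and practical numbers *)

Section UnitaryTotient.

Local Open Scope nat_scope.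

Lemma prime_power_ind (P : nat -> Prop) : P 1 ->
  (forall m p k, prime p -> ~~ (p %| m) -> 0 < m -> P m -> P (m * p ^ k)) ->
  forall n, 0 < n -> P n.
Proof.
move=> P1 IHP; elim/ltn_ind => n IH n0.
have [n1|n1] := leqP n 1; first by have -> : n = 1 by lia.
pose p := pdiv n; have pp : prime p := pdiv_prime n1.
rewrite -(partnC p n0) p_part mulnC; apply: IHP => //.
- by rewrite -p'natE //; exact: part_pnat.
- apply: IH; rewrite ?part_gt0 //.
  have := partnC p n0; have : 1 < n`_p by rewrite p_part_gt1 pi_pdiv.
  have := part_gt0 p^' n; nia.
Qed.

Lemma divisors_mul_primeX m p k : prime p -> ~~ (p %| m) -> 0 < m ->
  perm_eq (divisors (m * p ^ k.+1))
          (divisors (m * p ^ k) ++ [seq d * p ^ k.+1 | d <- divisors m]).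
Proof.
move=> pp pm m0; have p0 := prime_gt0 pp.
have pk0 j : 0 < m * p ^ j by rewrite muln_gt0 m0 expn_gt0 p0.
have inj : injective (muln^~ (p ^ k.+1)).
  by move=> a b /eqP; rewrite eqn_pmul2r ?expn_gt0 ?p0 // => /eqP.
apply: uniq_perm; rewrite ?divisors_uniq //.
  rewrite cat_uniq divisors_uniq map_inj_uniq ?divisors_uniq // andbT /=.
  apply/hasPn => x /mapP[d _ ->]; rewrite -dvdn_divisors //.
  apply: contra pm => /(dvdn_trans (dvdn_mull d (dvdnn _))).
  by rewrite expnS dvdn_pmul2r // expn_gt0 p0.
move=> d; rewrite mem_cat -!dvdn_divisors //; apply/idP/orP.
  move=> dm; have [dk|dk] := boolP (d %| m * p ^ k); [by left|right].
  have d0 : 0 < d by apply: dvdn_gt0 dm.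
  have lk : p ^ k.+1 %| d.
    rewrite pfactor_dvdn // ltnNge; apply: contra dk => lk.
    rewrite -(partnC p d0) p_part mulnC; apply: dvdn_mul; last by apply: dvdn_exp2l.
    have : d`_p^' %| m * p ^ k.+1 by apply: dvdn_trans dm; exact: dvdn_part.
    rewrite Gauss_dvdl // coprimeXr // coprime_sym prime_coprime // -p'natE //.
    exact: part_pnat.
  apply/mapP; exists (d %/ p ^ k.+1); last by rewrite divnK.
  by rewrite -dvdn_divisors // -(@dvdn_pmul2r (p ^ k.+1)) ?expn_gt0 ?p0 // divnK.
case=> [/dvdn_trans -> //|/mapP[e]]; first by rewrite expnS mulnCA dvdn_mull.
by rewrite -dvdn_divisors // => em ->; rewrite dvdn_pmul2r // expn_gt0 p0.
Qed.

Lemma ustar_mul_primeX m p k : prime p -> ~~ (p %| m) -> 0 < m ->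
  ustar (m * p ^ k.+1) = ustar m * (p ^ k.+1 - 1).
Proof.
move=> pp pm m0; have p0 := prime_gt0 pp.
have pk0 : 0 < p ^ k.+1 by rewrite expn_gt0 p0.
have pE : perm_eq (primes (m * p ^ k.+1)) (p :: primes m).
  apply: uniq_perm; rewrite ?primes_uniq //= ?primes_uniq ?andbT.
    by rewrite mem_primes pp m0.
  by move=> q; rewrite primesM // primesX // (primes_prime pp) mem_seq1 in_cons orbC.
rewrite /ustar (perm_big _ pE) big_cons [RHS]mulnC; congr (_ * _).
  by rewrite lognM // pfactorK // logn_coprime ?prime_coprime.
rewrite [LHS]big_seq [RHS]big_seq; apply: eq_bigr => q; rewrite mem_primes => /and3P[pq _ qm].
  rewrite lognM // lognX (lognE q p) pq p0.
  have -> : q %| p = false.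
    by apply/negbTE; apply: contra pm; rewrite dvdn_prime2 // => /eqP <-.
by rewrite muln0 addn0.
Qed.

Lemma Sf_mul_primeX_step m p k : prime p -> ~~ (p %| m) -> 0 < m ->
  Sf ustar (m * p ^ k.+1) = Sf ustar (m * p ^ k) + Sf ustar m * (p ^ k.+1 - 1).
Proof.
move=> pp pm m0; rewrite /Sf (perm_big _ (divisors_mul_primeX k pp pm m0)) big_cat /=.
congr (_ + _); rewrite big_map big_distrl /= big_seq [RHS]big_seq; apply: eq_bigr => d.
rewrite -dvdn_divisors // => dm; rewrite ustar_mul_primeX // ?(dvdn_gt0 m0 dm) //.
by apply: contra pm => /dvdn_trans; apply.
Qed.

Lemma ustar1 : ustar 1 = 1. Proof. by rewrite /ustar big_nil. Qed.

Lemma Sf1 : Sf ustar 1 = 1.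
Proof. by rewrite /Sf /divisors /= big_seq1 ustar1. Qed.

Lemma prime_notdvd1 p : prime p -> ~~ (p %| 1).
Proof. by rewrite dvdn1; case: eqP => // ->. Qed.

Lemma Sf_primeXS p k : prime p -> Sf ustar (p ^ k.+1) = Sf ustar (p ^ k) + (p ^ k.+1 - 1).
Proof.
move=> pp; have := Sf_mul_primeX_step k pp (prime_notdvd1 pp) isT.
by rewrite !mul1n Sf1 mul1n.
Qed.

Lemma Sf_mul_primeX m p k : prime p -> ~~ (p %| m) -> 0 < m ->
  Sf ustar (m * p ^ k) = Sf ustar m * Sf ustar (p ^ k).
Proof.
move=> pp pm m0; elim: k => [|k IH]; first by rewrite expn0 muln1 Sf1 muln1.
by rewrite Sf_mul_primeX_step // IH Sf_primeXS // mulnDr.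
Qed.

Lemma Sf_prime p : prime p -> Sf ustar p = p.
Proof.
move=> pp; have := Sf_primeXS 0 pp; rewrite expn0 expn1 Sf1 => ->.
by rewrite subnKC // prime_gt0.
Qed.

Lemma Sf_primeX_bounds p k : prime p -> p ^ k <= Sf ustar (p ^ k) <= 2 * p ^ k.
Proof.
move=> pp; elim: k => [|k IH]; first by rewrite expn0 Sf1.
have p2 := prime_gt1 pp; have pk : 0 < p ^ k by rewrite expn_gt0 prime_gt0.
rewrite Sf_primeXS //; move: IH; rewrite expnS; nia.
Qed.

Lemma SfM a b : coprime a b -> 0 < a -> 0 < b -> Sf ustar (a * b) = Sf ustar a * Sf ustar b.
Proof.
move=> cab a0 b0; move: b b0 cab; apply: prime_power_ind => [_|m p k pp pm m0 IH].
  by rewrite muln1 Sf1 muln1.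
case: k => [|k]; first by rewrite expn0 !muln1.
rewrite coprimeMr coprime_pexpr // => /andP[/IH {}IH].
rewrite coprime_sym prime_coprime // => pa.
rewrite mulnA !Sf_mul_primeX ?IH ?mulnA ?muln_gt0 ?a0 //.
by rewrite Euclid_dvdM // negb_or pa.
Qed.

Lemma Sf_ge n : 0 < n -> n <= Sf ustar n.
Proof.
move: n; apply: prime_power_ind => [|m p k pp pm m0 IH]; first by rewrite Sf1.
by rewrite Sf_mul_primeX // leq_mul //; have /andP[] := Sf_primeX_bounds k pp.
Qed.

Lemma potential_lg_Sf (R : realType) : potential (fun n => lg R (Sf ustar n)).
Proof.
split=> [a b cab a0 b0|n n0|p pp|p k pp].
- by rewrite SfM // lgM // (leq_trans _ (Sf_ge _)).
- by apply/le_lg/Sf_ge.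
- by rewrite Sf_prime.
- have p0 := prime_gt0 pp; case: k => [|k]; first by rewrite expn0 Sf1 lg1 !mulr0 mul0r.
  rewrite (_ : (2 * k.+1%:R * lg R p = lg R (p ^ (2 * k.+1)))%R); last by rewrite lgX // natrM.
  apply: le_lg; have /andP[_ /leq_trans ->] // := Sf_primeX_bounds k.+1 pp.
  have -> : p ^ (2 * k.+1) = p ^ k.+1 * p ^ k.+1 by rewrite mul2n -addnn expnD.
  rewrite leq_mul2r; apply/orP; right.
  by rewrite expnS; have := prime_gt1 pp; have : 0 < p ^ k by [rewrite expn_gt0 p0]; nia.
Qed.

Lemma Sf_sum N n : 0 < N -> N <= n ->
  Sf ustar N = \sum_(0 <= d < n.+1 | d %| N) ustar d.
Proof.
move=> N0 Nn; rewrite /Sf -[RHS]big_filter; apply: perm_big; apply: uniq_perm.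
- exact: divisors_uniq.
- by rewrite filter_uniq // iota_uniq.
move=> d; rewrite mem_filter mem_index_iota -dvdn_divisors //=.
by case: (boolP (d %| N)) => // /(dvdn_leq N0) dN; rewrite ltnS (leq_trans dN).
Qed.

Lemma Sf_dvd d n : d %| n -> 0 < n -> Sf ustar d <= Sf ustar n.
Proof.
move=> dn n0; have d0 := dvdn_gt0 n0 dn.
rewrite (Sf_sum d0 (dvdn_leq n0 dn)) (Sf_sum n0 (leqnn n)).
rewrite big_mkcond [X in _ <= X]big_mkcond; apply: leq_sum => e _.
by case: ifP => // /dvdn_trans /(_ dn) ->.
Qed.

Lemma ustar_ge q d : prime q -> q %| d -> 0 < d -> q - 1 <= ustar d.
Proof.
move=> pq qd d0; rewrite /ustar (bigD1_seq q) ?primes_uniq ?mem_primes ?pq ?d0 //=.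
have h : 0 < \prod_(p <- primes d | p != q) (p ^ logn p d - 1).
  rewrite big_seq_cond prodn_cond_gt0 // => p /andP[+ _].
  rewrite mem_primes => /and3P[pp _ pd]; rewrite subn_gt0.
  rewrite -{1}(expn0 p) ltn_exp2l ?prime_gt1 // logn_gt0 mem_primes pp d0 pd.
  by [].
apply: leq_trans (leq_pmulr _ h); rewrite leq_sub2r //.
rewrite -{1}(expn1 q) leq_exp2l ?prime_gt1 // logn_gt0 mem_primes pq d0 qd //.
Qed.

Definition lowpart y n : nat := n`_[pred q | q <= y].

Lemma lowpartE y n : lowpart y n = \prod_(0 <= p < y.+1) p ^ logn p n.
Proof.
rewrite /lowpart (widen_partn _ (leq_maxl n y)).
by rewrite [RHS](big_nat_widen _ _ (maxn n y).+1) // ltnS leq_maxr.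
Qed.

Lemma lowpart0 n : lowpart 0 n = 1.
Proof. by rewrite lowpartE big_nat1. Qed.

Lemma lowpartS y n : lowpart y.+1 n = lowpart y n * y.+1 ^ logn y.+1 n.
Proof. by rewrite !lowpartE big_nat_recr. Qed.

Lemma lowpart_gt0 y n : 0 < lowpart y n. Proof. exact: part_gt0. Qed.

Lemma lowpart_dvd y n : lowpart y n %| n. Proof. exact: dvdn_part. Qed.

Lemma lowpart_id y n : 0 < n -> (forall p, prime p -> p %| n -> p <= y) -> lowpart y n = n.
Proof.
move=> n0 H; apply: part_pnat_id; by apply/pnatP.
Qed.

Lemma dvdn_lowpart y d n : 0 < n -> d %| n -> (forall p, prime p -> p %| d -> p <= y) ->
  d %| lowpart y n.
Proof.
move=> n0 dn H; by rewrite -(@lowpart_id y d) ?partn_dvd // (dvdn_gt0 n0 dn).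
Qed.

Lemma prime_notdvd_lowpart p y n : prime p -> y < p -> ~~ (p %| lowpart y n).
Proof.
move=> pp yp; apply/negP => pd; have := part_pnat [pred z | z <= y] n.
by move/(pnat_dvd pd); rewrite pnatE // inE /= leqNgt yp.
Qed.

(* [p - 2] must be a sum of values [ustar d < p - 1], so only divisors with all primes below [p]
   contribute. *)
Lemma practical_prime_le n p : 0 < n -> f_practical ustar n -> prime p -> p %| n ->
  p <= Sf ustar (lowpart p.-1 n) + 2.
Proof.
move=> n0 /forallP prac pp pn; rewrite leqNgt; apply/negP => big.
set S := Sf ustar _ in big; have p0 := prime_gt0 pp.
have pS : p - 2 < (Sf ustar n).+1.
  by have := Sf_ge n0; have := dvdn_leq n0 pn; lia.
have := prac (Ordinal pS); have -> /= : 0 < Ordinal pS by rewrite /=; lia.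
case/existsP => D /andP[/subsetP sD /eqP E].
suff : \sum_(d in D) ustar d <= S by rewrite E; lia.
have low_le : lowpart p.-1 n <= n by apply: dvdn_leq => //; exact: lowpart_dvd.
rewrite /S (Sf_sum (lowpart_gt0 _ _) low_le) big_mkord.
rewrite big_mkcond [X in _ <= X]big_mkcond; apply: leq_sum => d _.
case: ifP => // dD; have := sD d dD; rewrite inE => /andP[d0 dn].
rewrite dvdn_lowpart // => q pq qd.
have : ustar d <= p - 2 by rewrite -E (bigD1 d) //= leq_addr.
by have := ustar_ge pq qd d0; lia.
Qed.

End UnitaryTotient.

(** * Upper bound *)

Lemma mem_survivors (R : realType) (phi : nat -> R) K c0 m y : (0 < m)%N ->
  (forall q, logn q m < K)%N ->
  (forall p, prime p -> (p <= y)%N -> Lam phi K 0 p.-1 + c0 <= phi (lowpart p.-1 m)) ->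
  lowpart y m \in survivors phi K 0 1 c0 y.
Proof.
move=> m0 mK; elim: y => [|y IH] alive; first by rewrite lowpart0 inE.
have {}IH := IH (fun p pp py => alive p pp (leqW py)).
rewrite lowpartS /survivors -/survivors; case: ifP => [/andP[py _]|npr]; last first.
  by rewrite lognE; move: npr; rewrite andbT => ->; rewrite expn0 muln1.
apply/allpairsP; exists (lowpart y m, logn y.+1 m); rewrite mem_filter IH mem_index_iota mK.
by rewrite andbT /=; split=> //; exact: alive py (leqnn _).
Qed.

Section UpperBound.
Variable R : realType.
Local Notation lg := (lg R).
Local Notation phiS := (fun n => lg (Sf ustar n)).

Section PracticalNumber.
Variables (x s n : nat).
Hypotheses (n_le : (n <= x)%N) (n_gt : (x < 2 * n)%N) (n_gt1 : (1 < n)%N)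
  (s_le : (s ^ 2 <= x)%N) (s_gt : (x < s.+1 ^ 2)%N)
  (n_prac : f_practical ustar n).

Let p := max_pdiv n.
Let m := (n %/ p)%N.

Let pp : prime p. Proof. exact: max_pdiv_prime. Qed.
Let p0 : (0 < p)%N. Proof. exact: prime_gt0. Qed.
Let n0 : (0 < n)%N. Proof. exact: ltnW. Qed.
Let nE : n = (m * p)%N. Proof. by rewrite /m divnK // max_pdiv_dvd. Qed.
Let m0 : (0 < m)%N. Proof. by move: n0; rewrite nE muln_gt0 => /andP[]. Qed.
Let p_max q : prime q -> (q %| n)%N -> (q <= p)%N.
Proof. by move=> pq qn; apply: max_pdiv_max; rewrite mem_primes pq n0. Qed.

Let lowpart_dvd_cofactor q : (q <= p)%N -> (0 < q)%N -> (lowpart q.-1 n %| m)%N.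
Proof.
move=> qp q0; have := lowpart_dvd q.-1 n; rewrite [X in (_ %| X)%N -> _]nE => h.
rewrite -(@Gauss_dvdl _ _ p) //.
by rewrite coprime_sym prime_coprime // prime_notdvd_lowpart // prednK.
Qed.

Let q_le_s q : prime q -> (q %| m)%N -> (q <= s)%N.
Proof.
move=> pq qm; have qn : (q * p %| n)%N by rewrite nE dvdn_pmul2r.
have qp : (q <= p)%N by apply: p_max => //; apply: dvdn_trans qn; exact: dvdn_mulr.
have h := dvdn_leq n0 qn; rewrite -ltnS -(@ltn_exp2r _ _ 2) //.
apply: leq_ltn_trans s_gt; apply: leq_trans n_le; apply: leq_trans h.
by rewrite expnS expn1 leq_mul2l qp orbT.
Qed.

Lemma sqrt_le_Sf_cofactor : (s <= 2 * Sf ustar (n %/ max_pdiv n) + 2)%N.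
Proof.
rewrite -/p -/m; have [ps|sp] := leqP p s.
  have := Sf_ge m0; move: n_gt s_le; rewrite nE expnS expn1; nia.
have := practical_prime_le n0 n_prac pp (max_pdiv_dvd n).
have := Sf_dvd (lowpart_dvd_cofactor (leqnn p) p0) m0; lia.
Qed.

Lemma lg_Sf_cofactor_ge : 12 <= lg x -> lg x / 4 <= lg (Sf ustar (n %/ max_pdiv n)).
Proof.
move=> lx; have := sqrt_le_Sf_cofactor; rewrite -/p -/m => sS.
have S0 := leq_trans m0 (Sf_ge m0).
have : (x <= (8 * Sf ustar m) ^ 2)%N.
  apply: leq_trans (ltnW s_gt) _; rewrite leq_exp2r //; lia.
move/(le_lg R); rewrite lgX ?muln_gt0 // lgM // (lgX R 3 (isT : 0 < 2)%N).
by have := lg2_le1 R; lra.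
Qed.

Lemma cofactor_survives (c0 C3 : R) Y :
  (forall K y, (1 < K)%N -> (0 < y)%N -> Lam phiS K 0 y <= lg y + C3) ->
  c0 = - (C3 + 2) -> (max_pdiv n < Y)%N ->
  (n %/ max_pdiv n)%N \in survivors phiS x.+1 0 1 c0 (minn Y s).
Proof.
move=> HL c0E; rewrite -/p -/m => pi; set y := minn _ _.
have mn : (m <= n)%N by rewrite nE leq_pmulr.
have smooth q : prime q -> (q %| m)%N -> (q <= y)%N.
  move=> pq qm; rewrite leq_min q_le_s // andbT ltnW //; apply: leq_ltn_trans pi.
  by apply: p_max => //; rewrite nE dvdn_mulr.
rewrite -(lowpart_id m0 smooth); apply: mem_survivors => //.
  move=> q; apply: leq_trans (ltn_logl q m0) _; lia.
move=> q pq qy; set N := lowpart q.-1 m.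
have qS : (q <= 2 * Sf ustar N + 2)%N.
  have [/allP small|] := boolP (all (fun r => r < q)%N (primes m)).
    have -> : N = m.
      apply: lowpart_id => // r pr rm.
      by have := small r; rewrite mem_primes pr m0 rm => /(_ isT); lia.
    apply: leq_trans sqrt_le_Sf_cofactor; apply: leq_trans qy _; exact: geq_minr.
  case/allPn => r0; rewrite mem_primes -leqNgt => /and3P[pr0 _ r0m] qr0.
  have ex : exists r, [&& prime r, (r %| m)%N & (q <= r)%N] by exists r0; rewrite pr0 r0m.
  case: (ex_minnP ex) => r /and3P[pr rm qr] rmin.
  have rp : (r <= p)%N by apply: p_max => //; rewrite nE dvdn_mulr.
  have rn : (r %| n)%N by rewrite nE dvdn_mulr.
  have h := practical_prime_le n0 n_prac pr rn.
  have dm := lowpart_dvd_cofactor rp (prime_gt0 pr).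
  have dN : (lowpart r.-1 n %| N)%N.
    apply: dvdn_lowpart => // z pz zd.
    rewrite -ltnS prednK ?prime_gt0 // ltnNge; apply/negP => qz.
    have := rmin z; rewrite pz (dvdn_trans zd dm) qz => /(_ isT) rz.
    by move: zd; apply/negP/prime_notdvd_lowpart; rewrite // prednK // prime_gt0.
  apply: leq_trans qr (leq_trans h _); rewrite leq_add2r.
  by apply: leq_trans (Sf_dvd dN (lowpart_gt0 _ _)) _; rewrite leq_pmull.
have N0 : (0 < Sf ustar N)%N := leq_trans (lowpart_gt0 _ _) (Sf_ge (lowpart_gt0 _ _)).
have q1 := prime_gt1 pq; have q1' : (0 < q.-1)%N by rewrite -ltnS prednK // ltnW.
have := HL x.+1 q.-1 (leq_ltn_trans (ltnW n_gt1) (leq_ltn_trans n_le (ltnSn x))) q1'.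
have := le_lg R (leq_pred q).
have : lg q <= lg (2 ^ 2 * Sf ustar N) by apply: le_lg; lia.
rewrite lgM // lgX //; have := lg2_le1 R; rewrite c0E; lra.
Qed.

End PracticalNumber.

Lemma theta_cofactor_le x m : (0 < m)%N ->
  \sum_(0 <= p < x.+1 | prime p && (m * p <= x)%N) lg p <= 2 * (x%:R / m%:R).
Proof.
move=> m0; apply: (@le_trans _ _ (\sum_(0 <= p < (x %/ m).+1 | prime p) lg p)).
  rewrite [X in _ <= X](big_nat_widen _ _ x.+1) ?ltnS ?leq_div //.
  by rewrite le_eqVlt; apply/orP; left; apply/eqP/eq_bigl => p; rewrite ltnS leq_divRL // mulnC.
apply: le_trans (theta_le R _) _; apply: ler_wpM2l => //.
by rewrite ler_pdivlMr ?ltr0n // -natrM ler_nat leq_trunc_div.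
Qed.

Definition practical_upto x := [seq n <- index_iota 1 x.+1 | f_practical ustar n & (x < 2 * n)%N].

(* [lg (max_pdiv n)] varies by a factor 2 in a class. *)
Definition in_class i n := (2 ^ 2 ^ i <= max_pdiv n < 2 ^ 2 ^ i.+1)%N.

Lemma class_count_le : exists2 C : R, 0 < C & exists x0 : nat, forall x i, (x0 <= x)%N ->
  \sum_(n <- practical_upto x | in_class i n) 1 <= C * (2 ^ i)%:R * (x%:R / lg x ^+ 2).
Proof.
have [C3 C3_gt0 HL] := Lam_bounds R 0.
pose c0 := - (C3 + 2).
have [D D0 HD] := @survivors_moments R 0 1 c0 0 isT
  ltac:(by move=> p pp; rewrite dvdn1 => /eqP E; rewrite E in pp).
exists (256 * D); first by rewrite mulr_gt0.
have [x0 Hx0] := lg_unbounded (12 : R); exists (x0 + 5)%N => x i x_ge.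
have lx := Hx0 x ltac:(lia).
have [s /andP[s_le s_gt]] := root_nat x (isT : 0 < 2)%N.
have s2 : (1 < s)%N by rewrite -(@ltn_exp2r _ _ 2) // -ltnS; move: s_gt; case: (s) => [|[|]] //; lia.
have [Y [Y1 Y_gt lY]] : exists Y, [/\ (1 < Y)%N,
    forall n, in_class i n -> (max_pdiv n < Y)%N & lg Y <= 2 * (2 ^ i)%:R].
  exists (2 ^ 2 ^ i.+1)%N; split=> [|n /andP[]//|].
    by apply: (@leq_trans (2 ^ 1)) => //; rewrite leq_exp2l // expn_gt0.
  rewrite lgX // expnS natrM -[X in _ <= X]mulr1.
  by apply: ler_wpM2l; [rewrite mulr_ge0|exact: lg2_le1].
pose y := minn Y s.
have y1 : (1 < y)%N by rewrite leq_min Y1.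
have phiP := potential_lg_Sf R.
have K1 : (1 < x.+1)%N by lia.
have m0_ge : c0 - 49 <= lg (Sf ustar 1) by rewrite Sf1 lg1 /c0; lra.
have [_ M2] := HD phiS x.+1 phiP K1 m0_ge ltac:(by rewrite /= Sf1 lg1) y y1.
have m1_smooth p : prime p -> (p %| 1)%N -> (p <= 0)%N.
  by move=> pp; rewrite (negbTE (prime_notdvd1 pp)).
have smooth := @survivors_smooth R phiS x.+1 0 1 c0 isT m1_smooth y.
have unq := @survivors_uniq R phiS x.+1 0 1 c0 isT m1_smooth y.
set A := survivors _ _ _ _ _ _ in M2 smooth unq.
pose P2 := fun u : nat * nat => [&& prime u.2, (u.1 * u.2 <= x)%N & lg x / 4 <= phiS u.1].
have key : \sum_(n <- practical_upto x | in_class i n) lg (max_pdiv n) <=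
   \sum_(u <- [seq (m, p) | m <- A, p <- index_iota 0 x.+1] | P2 u) lg u.2.
  rewrite -big_filter -(big_map (fun n => (n %/ max_pdiv n, max_pdiv n)%N) predT (fun u => lg u.2)).
  have inP n : n \in [seq n <- practical_upto x | in_class i n] ->
     [/\ (n <= x)%N, (x < 2 * n)%N, (1 < n)%N, f_practical ustar n & in_class i n].
    rewrite !mem_filter mem_index_iota => /and3P[-> /andP[-> h] /andP[_ h2]]; split => //; lia.
  apply: ler_sum_sub.
  - rewrite map_inj_in_uniq ?filter_uniq ?iota_uniq // => a b _ _ [e1 e2].
    by rewrite -(divnK (max_pdiv_dvd a)) e1 e2 divnK // max_pdiv_dvd.
  - by apply: allpairs_uniq; rewrite ?iota_uniq // => -[a b] [a' b'] _ _ [-> ->].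
  - move=> u /mapP[n /inP[nx xn n1 np ni] ->] _.
    have mA := @cofactor_survives x s n nx xn n1 s_le s_gt np c0 C3 Y
      (fun K y K1 y0 => proj2 (andP (HL phiS K y phiP K1 y0))) erefl (Y_gt n ni).
    apply/andP; split.
      apply/allpairsP; exists (n %/ max_pdiv n, max_pdiv n)%N; split=> //=.
      rewrite mem_index_iota /= ltnS; apply: leq_trans nx.
      exact: dvdn_leq (ltnW n1) (max_pdiv_dvd n).
    rewrite /P2 /= max_pdiv_prime // divnK ?max_pdiv_dvd // nx /=.
    exact: (lg_Sf_cofactor_ge nx xn n1 s_le s_gt np lx).
  - by move=> u _ _; exact: lg_ge0.
have rhs : \sum_(u <- [seq (m, p) | m <- A, p <- index_iota 0 x.+1] | P2 u) lg u.2 <=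
    2 * x%:R * (16 / lg x ^+ 2 * (D * lg y ^+ 2)).
  rewrite big_mkcond big_allpairs_dep /=.
  apply: (@le_trans _ _ (\sum_(m <- A) 2 * x%:R * (16 / lg x ^+ 2 * (lg (Sf ustar m) ^+ 2 / m%:R)))).
    rewrite big_seq [X in _ <= X]big_seq; apply: ler_sum => m /smooth[m0 _].
    rewrite -big_mkcond /P2 /=.
    have r0 : 0 <= 2 * x%:R * (16 / lg x ^+ 2 * (lg (Sf ustar m) ^+ 2 / m%:R)).
      by rewrite !mulr_ge0 ?invr_ge0 ?exprn_ge0 ?lg_ge0.
    have [h|h] := boolP (lg x / 4 <= lg (Sf ustar m)); last first.
      by rewrite big1 // => p; rewrite !andbF.
    under eq_bigl => p do rewrite andbT.
    apply: le_trans (theta_cofactor_le x m0) _.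
    have l2 : 0 < lg x ^+ 2 by rewrite exprn_gt0; lra.
    have h2 : lg x ^+ 2 <= 16 * lg (Sf ustar m) ^+ 2.
      have -> : 16 * lg (Sf ustar m) ^+ 2 = (4 * lg (Sf ustar m)) ^+ 2 by ring.
      by rewrite lerXn2r ?nnegrE; lra.
    rewrite -mulrA; apply: ler_wpM2l => //; apply: ler_wpM2l => //.
    have one : 1 <= 16 / lg x ^+ 2 * lg (Sf ustar m) ^+ 2.
      by rewrite mulrAC ler_pdivlMr // mul1r.
    by rewrite mulrA ler_peMl ?invr_ge0.
  rewrite -!mulr_sumr; apply: ler_wpM2l; first by rewrite mulr_ge0.
  by apply: ler_wpM2l => //; rewrite mulr_ge0 ?invr_ge0 ?sqr_ge0.
have lhs : (\sum_(n <- practical_upto x | in_class i n) 1) * ((2 ^ i)%:R / 2) <=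
     \sum_(n <- practical_upto x | in_class i n) lg (max_pdiv n).
  rewrite mulr_suml; apply: ler_sum => n /andP[h _]; rewrite mul1r.
  apply: le_trans (le_lg R h); rewrite lgX //; apply: ler_wpM2l => //.
  by have := lg2_ge R.
have ly : lg y ^+ 2 <= 4 * (2 ^ i)%:R ^+ 2.
  have -> : 4 * (2 ^ i)%:R ^+ 2 = (2 * (2 ^ i)%:R) ^+ 2 :> R by ring.
  rewrite lerXn2r ?nnegrE ?lg_ge0 ?mulr_ge0 //.
  by apply: le_trans (le_lg R (geq_minl _ _)) lY.
have i0 : 0 < (2 ^ i)%:R / 2 :> R by rewrite divr_gt0 ?ltr0n ?expn_gt0.
rewrite -(ler_pM2r i0); apply: le_trans lhs _; apply: le_trans key _; apply: le_trans rhs _.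
have q0 : 0 <= 32 * D * (x%:R / lg x ^+ 2) by rewrite !mulr_ge0 ?invr_ge0 ?sqr_ge0 // ltW.
by have := ler_wpM2l q0 ly; lra.
Qed.

Lemma practical_upto_le : exists2 C : R, 0 < C & exists x0 : nat, forall x, (x0 <= x)%N ->
  (size (practical_upto x))%:R <= C * (x%:R / lg x).
Proof.
have [C C0 [x0 H]] := class_count_le.
exists (4 * C); first by rewrite mulr_gt0.
exists (x0 + 4)%N => x x_ge.
pose T := trunc_log 2 x; pose I := (trunc_log 2 T).+1.
have x_gt0 : (0 < x)%N by lia.
have T1 : (0 < T)%N by rewrite /T trunc_log_gt0 /=; lia.
have lx0 : 0 < lg x by rewrite lg_gt0 //; lia.
apply: (@le_trans _ _ (\sum_(0 <= i < I) \sum_(n <- practical_upto x | in_class i n) 1)).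
  rewrite (exchange_big_dep predT) //= -sum1_size natr_sum.
  rewrite big_seq [X in _ <= X]big_seq; apply: ler_sum => n.
  rewrite mem_filter mem_index_iota => /andP[/andP[_ xn] /andP[_ nx]].
  pose p := max_pdiv n; pose t := trunc_log 2 p; pose i := trunc_log 2 t.
  have n1 : (1 < n)%N by lia.
  have p1 : (1 < p)%N by apply/prime_gt1/max_pdiv_prime.
  have px : (p <= x)%N by apply: (@leq_trans n) => //; apply: dvdn_leq (max_pdiv_dvd n); lia.
  have t0 : (0 < t)%N by rewrite /t trunc_log_gt0 /=; lia.
  have /andP[h1 h2] := trunc_log_bounds (isT : 1 < 2)%N (ltnW p1).
  have /andP[h3 h4] := trunc_log_bounds (isT : 1 < 2)%N t0.
  have cl : in_class i n.
    rewrite /in_class -/p; apply/andP; split.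
      by apply: leq_trans h1; rewrite leq_exp2l.
    by apply: leq_trans h2 _; rewrite leq_exp2l.
  have iI : (i < I)%N by rewrite /I ltnS; apply: leq_trunc_log; apply: leq_trunc_log.
  rewrite big_mkcond /= (bigD1_seq i) ?mem_index_iota ?iota_uniq //= cl.
  by rewrite lerDl sumr_ge0 // => j _; case: ifP.
apply: (@le_trans _ _ (\sum_(0 <= i < I) (2 ^ i)%:R * (C * (x%:R / lg x ^+ 2)))).
  apply: ler_sum => i _; rewrite mulrA (mulrC (2 ^ i)%:R); apply: H; lia.
rewrite -mulr_suml.
have -> : \sum_(0 <= i < I) (2 ^ i)%:R = (2 ^ I)%:R - 1 :> R.
  elim: (I) => [|j IH]; first by rewrite big_geq // subrr.
  by rewrite big_nat_recr //= IH expnS natrM; ring.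
have I4 : (2 ^ I)%:R <= 4 * lg x.
  have /andP[h1 _] := trunc_log_bounds (isT : 1 < 2)%N x_gt0.
  have /andP[h3 _] := trunc_log_bounds (isT : 1 < 2)%N T1.
  have := le_lg R h1; rewrite lgX // -/T => h.
  have : (2 ^ I)%:R <= 2 * T%:R :> R by rewrite /I expnS natrM ler_wpM2l // ler_nat.
  by have := ler_wpM2l (ler0n R T) (lg2_ge R); lra.
have q0 : 0 <= C * (x%:R / lg x ^+ 2) by rewrite !mulr_ge0 ?invr_ge0 ?sqr_ge0 // ltW.
rewrite [X in _ <= X](_ : _ = 4 * lg x * (C * (x%:R / lg x ^+ 2))); last by field; lra.
by apply: ler_wpM2r => //; lra.
Qed.

Lemma count_practical_upper : exists2 C : R, 0 < C & forall N : nat, (1 < N)%N ->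
  (F_count ustar N)%:R <= C * (N%:R / lg N).
Proof.
have [C C0 [x0 H]] := practical_upto_le.
have [n1 Hn1] := lg_unbounded (6 : R); pose X1 := (n1 + x0 + 4)%N.
have F_le N : (F_count ustar N <= N)%N.
  by rewrite /F_count; apply: leq_trans (count_size _ _) _; rewrite size_iota.
exists (4 * C + lg X1); first by have := lg_ge0 R X1; lra.
elim/ltn_ind => N IH N1; have lN := lg_gt0 R N1.
have r0 : 0 <= N%:R / lg N by rewrite divr_ge0 // ltW.
have [NX|XN] := leqP N X1.
  apply: (@le_trans _ _ (lg X1 * (N%:R / lg N))); last by apply: ler_wpM2r => //; lra.
  apply: (@le_trans _ _ N%:R); first by rewrite ler_nat.
  rewrite mulrCA ler_peMr // ler_pdivlMr // mul1r; exact: le_lg.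
pose h := (N %/ 2)%N.
have h1 : (1 < h)%N by rewrite /h; rewrite /X1 in XN; lia.
have split : (F_count ustar N <= F_count ustar h + size (practical_upto N))%N.
  rewrite /F_count /practical_upto size_filter /index_iota subSS subn0.
  have -> : N = (h + (N - h))%N by rewrite /h; lia.
  rewrite iotaD !count_cat leq_add2l -(subnKC (_ : h <= N)%N); last by rewrite /h; lia.
  apply: leq_trans (leq_addl _ _).
  rewrite -!size_filter; apply: uniq_leq_size; rewrite ?filter_uniq ?iota_uniq // => z.
  by rewrite !mem_filter !mem_iota => /andP[-> hz] /=; rewrite /h in hz *; lia.
apply: (@le_trans _ _ ((F_count ustar h)%:R + (size (practical_upto N))%:R)).
  by rewrite -natrD ler_nat.
have IHh := IH h ltac:(rewrite /h; lia) h1.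
have HN := H N ltac:(rewrite /X1 in XN; lia).
have l6 := Hn1 N ltac:(rewrite /X1 in XN; lia).
have lh : lg N * (2 / 3) <= lg h.
  have : lg N <= lg (4 * h) by apply: le_lg; rewrite /h; lia.
  rewrite lgM ?(ltnW h1) // (lgX R 2 (isT : 0 < 2)%N); have := lg2_le1 R; lra.
have hN : h%:R <= N%:R / 2 :> R.
  by rewrite ler_pdivlMr // -natrM ler_nat leq_trunc_div.
have q : h%:R / lg h <= 3 / 4 * (N%:R / lg N).
  rewrite ler_pdivrMr ?lg_gt0 //.
  have := ler_wpM2l r0 lh.
  rewrite (_ : N%:R / lg N * (lg N * (2 / 3)) = N%:R * (2 / 3)); last by field; lra.
  lra.
have X0 := lg_ge0 R X1.
have c1 : 0 <= 4 * C + lg X1 by lra.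
have := ler_wpM2l c1 q.
have := mulr_ge0 X0 r0.
lra.
Qed.

End UpperBound.

(** * A sufficient condition *)

Section Chains.

Local Open Scope nat_scope.

Definition subset_sums_full n := forall t, t <= Sf ustar n ->
  exists b : pred nat, \sum_(d <- divisors n | b d) ustar d = t.

Lemma subset_sums_full_practical n : 0 < n -> subset_sums_full n -> f_practical ustar n.
Proof.
move=> n0 H; apply/forallP => -[t tS] /=; apply/implyP => _.
have [b bE] := H t tS.
apply/existsP; exists [set d : 'I_n.+1 | [&& 0 < d, d %| n & b d]].
apply/andP; split; first by apply/subsetP => d; rewrite !inE => /and3P[-> ->].
rewrite -bE; apply/eqP; under eq_bigl => d do rewrite inE.
rewrite -(big_mkord (fun d => [&& 0 < d, d %| n & b d])) -big_filter -[RHS]big_filter.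
apply: perm_big; apply: uniq_perm; rewrite ?filter_uniq ?iota_uniq ?divisors_uniq // => d.
rewrite !mem_filter mem_index_iota -dvdn_divisors //=.
case: (boolP (d %| n)) => [dn|]; last by rewrite !andbF.
by rewrite (dvdn_gt0 n0 dn) ltnS (dvdn_leq n0 dn) !andbT.
Qed.

Lemma subset_sums_full_mul_primeX m p k : prime p -> ~~ (p %| m) -> 0 < m ->
  p <= Sf ustar m -> subset_sums_full m -> subset_sums_full (m * p ^ k).
Proof.
move=> pp pm m0 pS fm; elim: k => [|k IH]; first by rewrite expn0 muln1.
move=> t; rewrite Sf_mul_primeX_step //.
set v := p ^ k.+1 - 1; set S := Sf ustar (m * p ^ k) => tS.
have pk : 1 < p ^ k.+1 by rewrite -(expn0 p) ltn_exp2l // prime_gt1.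
have v0 : 0 < v by rewrite subn_gt0.
have vS : v <= S.
  rewrite /S Sf_mul_primeX //; have /andP[h _] := Sf_primeX_bounds k pp.
  by apply: leq_trans (leq_subr _ _) _; rewrite expnS leq_mul.
have [a [c [aS cS tE]]] : exists a c, [/\ a <= S, c <= Sf ustar m & t = a + c * v].
  have [h|h] := leqP (Sf ustar m * v) t.
    exists (t - Sf ustar m * v), (Sf ustar m); split=> //; lia.
  exists (t %% v), (t %/ v); split.
  - by apply: leq_trans vS; apply: ltnW; rewrite ltn_mod.
  - by apply: ltnW; rewrite ltn_divLR.
  - by rewrite addnC -divn_eq.
have [b1 E1] := IH a aS; have [b2 E2] := fm c cS.
exists (fun d => if p ^ k.+1 %| d then b2 (d %/ p ^ k.+1) else b1 d).
rewrite (perm_big _ (divisors_mul_primeX k pp pm m0)) big_cat tE -E1 -E2 /=.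
have pk0 : 0 < p ^ k.+1 by apply: ltnW.
congr (_ + _).
  rewrite big_seq_cond [RHS]big_seq_cond; apply: eq_bigl => d.
  case: (boolP (d \in _)) => //=; rewrite -dvdn_divisors ?muln_gt0 ?m0 ?expn_gt0 ?prime_gt0 // => dm.
  case: ifP => // /dvdn_trans /(_ dm); rewrite expnS dvdn_pmul2r ?expn_gt0 ?prime_gt0 //.
  by rewrite (negbTE pm).
rewrite big_map big_distrl /= big_seq_cond [RHS]big_seq_cond.
apply: eq_big => d; first by rewrite dvdn_mull // mulnK.
rewrite -dvdn_divisors // => /andP[dm _]; rewrite ustar_mul_primeX // ?(dvdn_gt0 m0 dm) //.
by apply: contra pm => /dvdn_trans; apply.
Qed.

Lemma subset_sums_full1 : subset_sums_full 1.
Proof.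
move=> t; rewrite Sf1 => t1; exists (fun=> t == 1).
rewrite (_ : divisors 1 = [:: 1]) // big_mkcond big_seq1 ustar1.
by case: t t1 => [|[|]].
Qed.

Lemma subset_sums_full4 : subset_sums_full 4.
Proof.
have u1 := ustar1; have u2 : ustar 2 = 1 by rewrite /ustar unlock.
have u4 : ustar 4 = 3 by rewrite /ustar unlock.
have dE : divisors 4 = [:: 1; 2; 4] by vm_compute.
move=> t; rewrite /Sf dE !big_cons big_nil u1 u2 u4.
have E b : \sum_(d <- [:: 1; 2; 4] | b d) ustar d =
   (if b 1 then 1 else 0) + ((if b 2 then 1 else 0) + (if b 4 then 3 else 0)).
  by rewrite !big_cons big_nil u1 u2 u4; case: (b 1); case: (b 2); case: (b 4).
case: t => [|[|[|[|[|[|t]]]]]] // _.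
- by exists pred0; rewrite E.
- by exists (pred1 1); rewrite E.
- by exists (fun d => d <= 2); rewrite E.
- by exists (pred1 4); rewrite E.
- by exists (fun d => d != 2); rewrite E.
- by exists predT; rewrite E.
Qed.

(* With [2 ^ 2 || n] the induction on the primes of [n] can start at 4, for which [Sf ustar 4 = 5]. *)
Definition chain n := [/\ 0 < n, logn 2 n = 2 &
  forall p, prime p -> 2 < p -> p %| n -> p <= lowpart p.-1 n].

Lemma chain_practical n : chain n -> f_practical ustar n.
Proof.
case=> n0 n2 H; apply: subset_sums_full_practical => //.
rewrite -(@lowpart_id n n n0); last by move=> p _; apply: dvdn_leq.
elim: {1}n => [|y IH]; first by rewrite lowpart0; apply: subset_sums_full1.
rewrite lowpartS; have [/eqP l0|lp] := boolP (logn y.+1 n == 0).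
  by rewrite l0 expn0 muln1.
have /andP[py yn] : prime y.+1 && (y.+1 %| n).
  by move: lp; rewrite -lt0n logn_gt0 mem_primes n0 => /andP[-> ->].
have [y2|y2] := leqP y.+1 2; last first.
  apply: subset_sums_full_mul_primeX => //; first exact: prime_notdvd_lowpart.
    exact: lowpart_gt0.
  apply: leq_trans (H _ py y2 yn) _; apply: Sf_ge; exact: lowpart_gt0.
have -> : y = 1 by have := prime_gt1 py; lia.
rewrite n2 lowpartS lowpart0 exp1n !mul1n.
exact: subset_sums_full4.
Qed.

Lemma chain_mul_prime n q : chain n -> prime q -> 2 < q -> q <= n -> chain (n * q).
Proof.
case=> n0 n2 H pq q2 qn; have q0 := prime_gt0 pq.
have lowM y : lowpart y n <= lowpart y (n * q).
  by rewrite /lowpart partnM // leq_pmulr // part_gt0.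
split; first by rewrite muln_gt0 n0.
  rewrite lognM // n2 logn_coprime // prime_coprime // dvdn_prime2 //.
  by apply/negP => /eqP E; rewrite -E in q2.
move=> p pp p2 pnq; have [pn|pn] := boolP (p %| n).
  exact: leq_trans (H p pp p2 pn) (lowM _).
have pE : p = q by move: pnq; rewrite Euclid_dvdM // (negbTE pn) /= dvdn_prime2 // => /eqP.
apply: leq_trans (lowM _); rewrite pE.
have [/allP small|] := boolP (all (fun r => r < q) (primes n)).
  rewrite lowpart_id // => r pr rn.
  by have := small r; rewrite mem_primes pr n0 rn => /(_ isT); lia.
case/allPn => r0; rewrite mem_primes -leqNgt => /and3P[pr0 _ r0n] qr0.
have ex : exists r, [&& prime r, r %| n & q <= r] by exists r0; rewrite pr0 r0n.
case: (ex_minnP ex) => r /and3P[pr rn qr] rmin.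
apply: (leq_trans qr); apply: leq_trans (H r pr (leq_trans q2 qr) rn) _.
apply: dvdn_leq; first exact: lowpart_gt0.
apply: dvdn_lowpart => //; first exact: lowpart_dvd.
move=> z pz zd; rewrite -ltnS prednK // ltnNge; apply/negP => qz.
have := rmin z; rewrite pz (dvdn_trans zd (lowpart_dvd _ _)) qz => /(_ isT) rz.
by move: zd; apply/negP; apply: prime_notdvd_lowpart => //; rewrite prednK // prime_gt0.
Qed.

Lemma chain_4_3X b : chain (4 * 3 ^ b).
Proof.
have n0 : 0 < 4 * 3 ^ b by rewrite muln_gt0 expn_gt0.
split=> //.
  rewrite lognM ?expn_gt0 // (pfactorK 2 (isT : prime 2)) logn_coprime //.
  by rewrite coprimeXr.
move=> p pp p2; rewrite (Euclid_dvdM _ _ pp) => /orP[p4|].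
  have := @Euclid_dvdX 2 2 p pp; rewrite p4 => /esym/andP[/dvdn_leq -/(_ isT)]; lia.
rewrite Euclid_dvdX // => /andP[/dvdn_leq -/(_ isT) p3 _].
have -> : p = 3 by lia.
apply: (@leq_trans 4) => //; apply: dvdn_leq; first exact: lowpart_gt0.
apply: dvdn_lowpart => //; first by rewrite dvdn_mulr.
move=> q pq; rewrite -[4]/(2 ^ 2) Euclid_dvdX // => /andP[/dvdn_leq -> //].
Qed.

End Chains.

(** * Lower bound *)

Lemma succn_le_sqr y : (1 < y)%N -> (y.+1 <= y ^ 2)%N.
Proof. by rewrite expnS expn1 => y1; nia. Qed.

Lemma leq_succn_mul a b : (0 < a)%N -> (a.+1 * b <= 2 * a * b)%N.
Proof. by move=> a0; rewrite leq_mul2r; apply/orP; right; lia. Qed.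

Section LowerBound.
Variable R : realType.
Local Notation lg := (lg R).

Lemma survivors_chain (c0 : R) y0 m0 y : (2 < y0.+1)%N -> chain m0 ->
  (forall z, prime z.+1 -> lg z.+1 <= Lam lg 2 y0 z + c0) ->
  forall m, m \in survivors lg 2 y0 m0 c0 y -> chain m.
Proof.
move=> y02 cm0 HL; elim: y => [|y IH] m; first by rewrite inE => /eqP ->.
rewrite /survivors -/survivors; case: ifP => [/andP[py yy]|_]; last exact: IH.
case/allpairsP => -[a k] /= [+ k2 ->]; rewrite mem_filter => /andP[alive /IH ca].
move: k2; rewrite mem_index_iota; case: k => [|[|]] // _; first by rewrite expn0 muln1.
rewrite expn1; apply: chain_mul_prime => //; first by apply: leq_trans y02 _.
case: ca => a0 _ _; rewrite -(ler_lg_nat R) //.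
by apply: le_trans (HL y py) alive.
Qed.

(* [first_moment_ge] bounds the first logarithmic moment from below; by the second moment it is not
   carried by [m > y ^ H]. *)
Lemma chain_mass : exists H (k0 : R), [/\ (1 < H)%N, 0 < k0 & forall y, (1 < y)%N ->
  exists s : seq nat, [/\ uniq s,
    (forall m, m \in s -> [/\ chain m, (y <= m)%N & (m <= y ^ H)%N]) &
    k0 <= \sum_(m <- s) m%:R^-1]].
Proof.
have [C3 C3_gt0 HL] := Lam_bounds R 3.
pose c0 := C3 + 49.
have [n3 Hn3] := lg_unbounded (c0 + 1).
pose m0 := (4 * 3 ^ n3)%N.
have m0_gt0 : (0 < m0)%N by rewrite muln_gt0 expn_gt0.
have lm0 : c0 + 1 <= lg m0.
  by apply: Hn3; rewrite /m0; apply: (@leq_trans (3 ^ n3)); [apply/ltnW/ltn_expl|apply: leq_pmull].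
have m0_smooth p : prime p -> (p %| m0)%N -> (p <= 3)%N.
  move=> pp; rewrite Euclid_dvdM // => /orP[|].
    by rewrite (_ : 4 = 2 ^ 2)%N // Euclid_dvdX // => /andP[/dvdn_leq -/(_ isT)]; lia.
  by rewrite Euclid_dvdX // => /andP[/dvdn_leq -/(_ isT)].
have [D D0 HD] := survivors_moments c0 (lg m0) m0_gt0 m0_smooth.
have [c [C [c_gt0 C_gt0 HW]]] := euler_prod_bounds R 3.
have phiP := potential_lg R.
have m0_ge : c0 - 49 <= lg m0 by lra.
pose e := c / m0%:R.
have m0R : 0 < m0%:R :> R by rewrite ltr0n.
have e0 : 0 < e by rewrite divr_gt0.
pose H := (Num.bound (2 * D / e)).+2.
have He : 2 * D / e <= H%:R.
  have q0 : 0 <= 2 * D / e by rewrite !mulr_ge0 ?invr_ge0 // ltW.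
  by apply: le_trans (ltW (archi_boundP q0)) _; rewrite ler_nat; exact: leqW (leqnSn _).
have H0 : 0 < H%:R :> R by rewrite ltr0n.
exists H, (e / (2 * H%:R)); split=> //; first by rewrite divr_gt0 // mulr_gt0.
move=> y y1; have ly := lg_gt0 R y1.
have [_ M2] := HD lg 2 phiP isT m0_ge (lexx _) y y1.
have M1 := first_moment_ge c0 phiP (isT : 1 < 2)%N m0_gt0 m0_smooth y.
have smooth := @survivors_smooth R lg 2 3 m0 c0 m0_gt0 m0_smooth y.
have unq := @survivors_uniq R lg 2 3 m0 c0 m0_gt0 m0_smooth y.
have phi_ge := @survivors_phi_ge R lg 2 3 m0 c0 phiP isT m0_gt0 m0_smooth m0_ge y.
have Lam_gt z : prime z.+1 -> lg z.+1 <= Lam lg 2 3 z + c0.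
  move=> pz; have /andP[h _] := HL lg 2 z.+1 phiP isT isT.
  move: h; rewrite LamS; have := lam_le phiP (isT : 1 < 2)%N pz.
  by case: ifP => _; rewrite /c0; lra.
have ch := @survivors_chain c0 3 m0 y isT (chain_4_3X _) Lam_gt.
have /andP[L1 _] := HL lg 2 y phiP isT (ltnW y1).
have L0 := Lam_ge0 3 phiP (isT : 1 < 2)%N y.
have /andP[W1 _] := HW (wt R 2) y y1 (fun p pp => @wt_bounds R 2 p isT pp).
set A := survivors _ _ _ _ _ _ in M1 M2 smooth unq phi_ge ch.
exists [seq m <- A | (m <= y ^ H)%N]; split; first by rewrite filter_uniq.
  move=> m; rewrite mem_filter => /andP[mH mA]; split=> //; first exact: ch.
  have [m_gt0 _] := smooth m mA.
  rewrite -(ler_lg_nat R) // ?(ltnW y1) //.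
  by have := phi_ge m mA; rewrite /c0; lra.
rewrite big_filter.
have T1 : e * lg y <= \sum_(m <- A) lg m / m%:R.
  apply: (@le_trans _ _ (\sum_(m <- A) (lg m - Lam lg 2 3 y - c0) / m%:R)).
    apply: le_trans M1; rewrite /e mulrAC [X in X <= _]mulrC [X in _ <= X]mulrAC mulrC.
    apply: ler_wpM2r; first by rewrite invr_ge0.
    apply: le_trans W1 _; rewrite ler_peMl //; last by lra.
    by apply/ltW/sieve_mass_gt0.
  by apply: ler_sum => m _; apply: ler_wpM2r; rewrite ?invr_ge0 // /c0; lra.
have T2 : (\sum_(m <- A | ~~ (m <= y ^ H)%N) lg m / m%:R) * (H%:R * lg y) <= D * lg y ^+ 2.
  apply: le_trans M2; rewrite mulr_suml [X in X <= _]big_mkcond; apply: ler_sum => m _.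
  case: ifP => [|_]; last by rewrite divr_ge0 ?sqr_ge0.
  rewrite -ltnNge => /ltnW/(le_lg R); rewrite lgX ?(ltnW y1) // => h.
  rewrite mulrAC; apply: ler_wpM2r; first by rewrite invr_ge0.
  by rewrite expr2; apply: ler_wpM2l => //; exact: lg_ge0.
have T3 : \sum_(m <- A | (m <= y ^ H)%N) lg m / m%:R <=
    H%:R * lg y * \sum_(m <- A | (m <= y ^ H)%N) m%:R^-1.
  rewrite mulr_sumr; apply: ler_sum => m mH; apply: ler_wpM2r; first by rewrite invr_ge0.
  by rewrite -lgX ?(ltnW y1) // le_lg.
rewrite (bigID (fun m => m <= y ^ H)%N) /= in T1.
move: T1 T2 T3; set S1 := \sum_(_ <- _ | _) _; set S2 := \sum_(_ <- _ | _) _.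
set S3 := \sum_(_ <- _ | _) _ => T1 T2 T3.
have Hl : 0 < H%:R * lg y by rewrite mulr_gt0.
have T4 : S2 <= e / 2 * lg y.
  rewrite -(ler_pM2r Hl); apply: le_trans T2 _.
  have : D <= e / 2 * H%:R.
    move: He; rewrite ler_pdivrMr // => He; lra.
  move/(ler_wpM2r (sqr_ge0 (lg y))); rewrite expr2; lra.
rewrite ler_pdivrMr ?mulr_gt0 //.
have : e / 2 * lg y <= H%:R * S3 * lg y by lra.
by rewrite ler_pM2r //; lra.
Qed.

Definition chain_window N y i (s : seq nat) := uniq s /\
  forall m, m \in s -> [/\ chain m, (y <= m)%N, (m ^ 2 <= N * y ^ 2)%N &
                          (N <= m ^ 2)%N || (y ^ i <= m ^ 2)%N].

Lemma push_window H : (1 < H)%N -> exists2 k : R, 0 < k & exists y1, forall N y i s,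
  (y1 <= y)%N -> (N < y ^ (8 * H))%N -> chain_window N y i s ->
  exists2 s', chain_window N y i.+1 s' &
    k * \sum_(m <- s) m%:R^-1 <= \sum_(m <- s') (m%:R : R)^-1.
Proof.
move=> H1; have [y1 Hy1] := sum_primeV_sqrt_ge R 3.
pose J : R := 8 * H%:R + 2.
have J0 : 0 < J by rewrite /J; have : 0 <= H%:R :> R by []; lra.
exists (4 * (J + 1))^-1; first by rewrite invr_gt0; lra.
exists (y1 + 2)%N => N y i s y_ge Ny [us Hs].
have y_gt1 : (1 < y)%N by lia.
have ly := lg_gt0 R y_gt1.
have hQ := Hy1 y ltac:(lia); rewrite -/(large_primes 3 y) in hQ.
pose big := [seq m <- s | (N <= m ^ 2)%N]; pose small := [seq m <- s | ~~ (N <= m ^ 2)%N].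
pose Q := [seq q <- index_iota 0 y.+1 | large_primes 3 y q].
pose s' := undup (big ++ [seq (m * q)%N | m <- small, q <- Q]).
have win : chain_window N y i.+1 s'.
  split; first exact: undup_uniq.
  move=> n; rewrite mem_undup mem_cat => /orP[|].
    by rewrite mem_filter => /andP[Nm /Hs[h1 h2 h3 _]]; rewrite Nm; split.
  case/allpairsP => -[m q] /= [+ + ->]; rewrite !mem_filter mem_index_iota ltnS.
  move=> /andP[mN /Hs[cm ym _ hi]] /andP[/and3P[pq q3 yq] /= qy].
  have m_gt0 : (0 < m)%N by case: cm.
  have q0 := prime_gt0 pq.
  split.
  - by apply: chain_mul_prime => //; [exact: ltnW|exact: leq_trans ym].
  - by apply: leq_trans ym _; rewrite leq_pmulr.
  - by rewrite expnMn leq_mul ?leq_exp2r // ltnW // ltnNge.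
  - apply/orP; right; move: hi; rewrite (negbTE mN) /= => hi.
    by rewrite expnMn expnS mulnC leq_mul // ltnW.
exists s' => //; have [us' Hs'] := win.
rewrite ler_pdivrMl; last by lra.
have s'V0 : 0 <= \sum_(m <- s') m%:R^-1 :> R by rewrite sumr_ge0 // => m _; rewrite invr_ge0.
pose w n : R := \sum_(0 <= p < y.+1 | large_primes 3 y p && (p %| n)%N) 1.
have y_gt0 : (0 < y)%N := ltnW y_gt1.
have w_le n : n \in s' -> w n <= J.
  move=> /Hs'[[n0 _ _] _ nN _].
  have := count_large_primes_le R 3 y_gt0 n0; rewrite -/(w n) => h.
  have : lg (n ^ 2) <= lg (y ^ (8 * H) * y ^ 2).
    by apply: le_lg; apply: leq_trans nN _; rewrite leq_mul2r ltnW ?orbT.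
  rewrite -expnD !lgX // natrD natrM => h2.
  rewrite -(ler_pM2r ly) /J; lra.
have B : \sum_(m <- big) m%:R^-1 <= \sum_(m <- s') m%:R^-1 :> R.
  apply: ler_sum_sub => //; [exact: filter_uniq|move=> x xb _|by move=> x _ _; rewrite invr_ge0].
  by rewrite mem_undup mem_cat xb.
have S : 4^-1 * (\sum_(m <- small) m%:R^-1) <= J * \sum_(m <- s') m%:R^-1 :> R.
  apply: (@le_trans _ _ (\sum_(m <- small) \sum_(0 <= q < y.+1 | large_primes 3 y q) (m * q)%:R^-1)).
    rewrite mulr_sumr; apply: ler_sum => m _.
    under [X in _ <= X]eq_bigr => q _ do rewrite natrM invfM.
    by rewrite -mulr_sumr mulrC; apply: ler_wpM2l; rewrite ?invr_ge0.
  apply: (@le_trans _ _ (\sum_(n <- s') n%:R^-1 * w n)); last first.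
    rewrite mulr_sumr big_seq [X in _ <= X]big_seq; apply: ler_sum => n ns'.
    by rewrite mulrC; apply: ler_wpM2r; rewrite ?invr_ge0 // w_le.
  rewrite exchange_big /=.
  under [X in _ <= X]eq_bigr => n _ do rewrite /w mulr_sumr.
  rewrite [X in _ <= X](exchange_big_dep (large_primes 3 y)) /=; last by move=> ? ? _ /andP[].
  rewrite big_nat_cond [X in _ <= X]big_nat_cond; apply: ler_sum => q /andP[/andP[_ qy] lq].
  rewrite lq /=; have /and3P[pq _ _] := lq; have q0 := prime_gt0 pq.
  under [X in _ <= X]eq_bigr => n _ do rewrite mulr1.
  rewrite -(big_map (muln^~ q) predT (fun n => n%:R^-1)).
  apply: ler_sum_sub => //.
  - by rewrite map_inj_uniq ?filter_uniq // => a b /eqP; rewrite eqn_pmul2r // => /eqP.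
  - move=> x /mapP[m ms ->] _; rewrite dvdn_mull // andbT mem_undup mem_cat; apply/orP; right.
    by apply/allpairsP; exists (m, q); split=> //=; rewrite mem_filter lq mem_index_iota.
  - by move=> x _ _; rewrite invr_ge0.
have -> : \sum_(m <- s) m%:R^-1 = \sum_(m <- big) m%:R^-1 + \sum_(m <- small) m%:R^-1 :> R.
  by rewrite (bigID (fun m => N <= m ^ 2)%N) /= !big_filter.
by lra.
Qed.

Lemma iter_push_window H : (1 < H)%N -> exists2 k : R, 0 < k & exists y1, forall N y s i,
  (y1 <= y)%N -> (N < y ^ (8 * H))%N -> chain_window N y 0 s -> (i <= 8 * H)%N ->
  exists2 s', chain_window N y i s' &
    k * \sum_(m <- s) m%:R^-1 <= \sum_(m <- s') (m%:R : R)^-1.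
Proof.
move=> H1; have [k k0 [y1 P]] := push_window H1.
pose k' := Num.min k 1.
have k'0 : 0 < k' by rewrite lt_min k0 ltr01.
have k'1 : k' <= 1 by rewrite ge_min lexx orbT.
have k'k : k' <= k by rewrite ge_min lexx.
exists (k' ^+ (8 * H)); first by rewrite exprn_gt0.
exists y1 => N y s i y_ge Ny ws iH.
have s0 (t : seq nat) : 0 <= \sum_(m <- t) m%:R^-1 :> R.
  by rewrite sumr_ge0 // => m _; rewrite invr_ge0.
suff [s' ws' h] : exists2 s', chain_window N y i s' &
    k' ^+ i * \sum_(m <- s) m%:R^-1 <= \sum_(m <- s') (m%:R : R)^-1.
  exists s' => //; apply: le_trans h; apply: ler_wpM2r => //.
  by apply: ler_wiXn2l => //; exact: ltW.
elim: i {iH} => [|i [s1 w1 h1]]; first by exists s; rewrite // expr0 mul1r.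
have [s2 w2 h2] := P N y i s1 y_ge Ny w1; exists s2 => //.
apply: le_trans h2; rewrite exprS -mulrA; apply: ler_pM => //.
- exact: ltW.
- by rewrite mulr_ge0 // exprn_ge0 // ltW.
Qed.

(* By Mertens, the sum of [lg q / q] over [z / E < q <= z] is at least 1 once [lg E >= 8]. *)
Lemma count_primes_interval_ge : exists2 E : nat, (0 < E)%N & forall w z, (0 < w)%N ->
  (w * E <= z)%N -> (z < 2 * E * w)%N ->
  z%:R <= (2 * E)%:R * lg z * \sum_(0 <= q < z.+1 | prime q && (w < q)%N) 1 :> R.
Proof.
have [E HE] := lg_unbounded (8 : R).
exists E.+1 => // w z w0 wz zw; have lE := HE E.+1 (leqnSn E).
have z0 : (0 < z)%N by apply: leq_trans wz; rewrite muln_gt0 w0.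
have F0 p : prime p -> 0 <= lg p / p%:R by rewrite divr_ge0 // lg_ge0.
have [_ h] := sum_split_primes w z F0.
have h1 := mertens_lower R z0; have h2 := mertens_upper R w0.
have h3 := le_lg R wz; rewrite lgM // in h3.
have one : 1 <= \sum_(0 <= q < z.+1 | prime q && (w < q)%N) lg q / q%:R by lra.
rewrite -[X in X <= _]mulr1; apply: le_trans (ler_wpM2l (ler0n R z) one) _.
rewrite !mulr_sumr big_nat_cond [X in _ <= X]big_nat_cond; apply: ler_sum => q.
move=> /andP[/andP[_ qz] /andP[pq wq]].
have qR : 0 < q%:R :> R by rewrite ltr0n prime_gt0.
rewrite mulr1 mulrA ler_pdivrMr //.
have a1 : lg q <= lg z by apply: le_lg.
have a2 : z%:R <= (2 * E.+1)%:R * q%:R :> R.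
  by rewrite -natrM ler_nat; apply: leq_trans (ltnW zw) _; rewrite leq_mul2l ltnW ?orbT.
rewrite mulrAC; apply: ler_pM => //; exact: lg_ge0.
Qed.

Lemma count_practical_lower_large : exists2 l : R, 0 < l & exists N0, forall N, (N0 <= N)%N ->
  l * (N%:R / lg N) <= (F_count ustar N)%:R.
Proof.
have [H [k0 [H1 k0_gt0 HM]]] := chain_mass.
have [k k_gt0 [y1 HP]] := iter_push_window H1.
have [E E0 HE] := count_primes_interval_ge.
pose c : R := (4 * E)%:R * (8 * H%:R).
have HR : 0 < H%:R :> R by rewrite ltr0n; lia.
have c_gt0 : 0 < c by rewrite mulr_gt0 ?mulr_gt0 // ltr0n muln_gt0.
exists (k * k0 / c); first by rewrite !mulr_gt0 ?invr_gt0.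
pose Y := (y1 + E + 3)%N.
have H4 : (0 < 4 * H)%N by lia.
exists (Y ^ (4 * H))%N => N N_ge.
have [y /andP[yN Ny]] := root_nat N H4.
have Yy : (Y <= y)%N.
  by rewrite -ltnS -(@ltn_exp2r _ _ (4 * H)) //; apply: leq_ltn_trans Ny.
have y3 : (3 <= y)%N by rewrite /Y in Yy; lia.
have Ey : (E <= y)%N by rewrite /Y in Yy; lia.
have yy1 : (y1 <= y)%N by rewrite /Y in Yy; lia.
have y_gt1 : (1 < y)%N by lia.
have y_gt0 : (0 < y)%N by lia.
have N8 : (N < y ^ (8 * H))%N.
  apply: leq_trans Ny _; have -> : (8 * H = 2 * (4 * H))%N by lia.
  by rewrite [X in (_ <= X)%N]expnM leq_exp2r // succn_le_sqr.
have N_gt1 : (1 < N)%N.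
  apply: leq_trans yN; apply: (@leq_trans (y ^ 1)); first by rewrite expn1.
  by rewrite leq_exp2l.
have lN := lg_gt0 R N_gt1; have ly := lg_gt0 R y_gt1.
have [s0 [us0 Hs0 Ms0]] := HM y y_gt1.
have win0 : chain_window N y 0 s0.
  split=> // m /Hs0[cm ym mH]; have m_gt0 : (0 < m)%N by case: cm.
  split=> //; last by rewrite expn0 expn_gt0 m_gt0 orbT.
  apply: (@leq_trans N); last by rewrite leq_pmulr // expn_gt0 y_gt0.
  apply: leq_trans yN; apply: (@leq_trans ((y ^ H) ^ 2)); first by rewrite leq_exp2r.
  by rewrite -expnM leq_exp2l //; lia.
have [s [us Hs] Ms] := HP N y s0 (8 * H)%N yy1 N8 win0 (leqnn _).
have {}Hs m : m \in s -> [/\ chain m, (0 < m)%N, (N <= m ^ 2)%N & (m ^ 2 <= N * y ^ 2)%N].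
  move=> /Hs[cm ym h1 h2]; split=> //; first by case: cm.
  by move: h2 => /orP[//|/(leq_trans (ltnW N8))].
pose PR := [seq n <- iota 1 N | f_practical ustar n].
have F_E : (F_count ustar N)%:R = \sum_(n <- PR) 1 :> R.
  by rewrite /F_count -size_filter -/PR -sum1_size natr_sum.
pose Qc m q := [&& prime q, (y < q)%N & (m * q <= N)%N].
have step1 : N%:R * \sum_(m <- s) m%:R^-1 <=
    (4 * E)%:R * lg N * \sum_(m <- s) \sum_(0 <= q < N.+1 | Qc m q) 1.
  rewrite !mulr_sumr big_seq [X in _ <= X]big_seq; apply: ler_sum => m /Hs[_ m0 Nm mN].
  pose z := (N %/ m)%N; pose w := (z %/ E)%N.
  have zE : (z * m <= N < z.+1 * m)%N.
    by rewrite leq_trunc_div /= ltn_ceil.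
  have /andP[zE1 zE2] := zE.
  have z_ge : (y ^ 3 <= z)%N.
    rewrite leq_divRL // -(@leq_exp2r _ _ 2) // expnMn.
    apply: leq_trans (leq_mul (leqnn _) mN) _.
    rewrite mulnCA [X in (_ <= X)%N]expnS expn1 leq_mul2l -expnM -expnD.
    by apply/orP; right; apply: leq_trans yN; rewrite leq_exp2l // (@leq_mul 4 2 4 H).
  have w_ge : (y <= w)%N.
    rewrite leq_divRL //; apply: leq_trans z_ge; rewrite expnS expnS expn1.
    by rewrite leq_mul2l; apply/orP; right; apply: leq_trans Ey _; rewrite leq_pmulr.
  have w0 : (0 < w)%N by exact: leq_trans w_ge.
  have wz : (w * E <= z)%N by rewrite leq_trunc_div.
  have zw : (z < 2 * E * w)%N.
    apply: leq_trans (ltn_ceil z E0) _; rewrite -/w mulnAC; exact: leq_succn_mul.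
  have h := HE w z w0 wz zw.
  have zN : (z <= N)%N by apply: leq_div.
  have cnt : \sum_(0 <= q < z.+1 | prime q && (w < q)%N) 1 <=
       \sum_(0 <= q < N.+1 | Qc m q) 1 :> R.
    rewrite (big_nat_widen _ _ N.+1) //.
    rewrite big_mkcond [X in _ <= X]big_mkcond; apply: ler_sum => q _.
    case: ifP => [/andP[/andP[pq wq] qz]|_]; last by case: ifP.
    rewrite /Qc pq (leq_ltn_trans w_ge wq) /=.
    by have -> : (m * q <= N)%N by rewrite mulnC -leq_divRL // -ltnS.
  have mR : 0 < m%:R :> R by rewrite ltr0n.
  rewrite ler_pdivrMr //.
  have z0 : (0 < z)%N by apply: leq_trans z_ge; rewrite expn_gt0 y_gt0.
  have Nz : N%:R <= 2 * z%:R * m%:R :> R.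
    rewrite -!natrM ler_nat; apply: leq_trans (ltnW zE2) _; exact: leq_succn_mul.
  apply: le_trans Nz _; apply: ler_wpM2r => //.
  have lz : lg z <= lg N by apply: le_lg.
  set cN := \sum_(0 <= q < N.+1 | _) _ in cnt *.
  have cN0 : 0 <= cN by rewrite sumr_ge0.
  have e1 : (2 * E)%:R * lg z * \sum_(0 <= q < z.+1 | prime q && (w < q)%N) 1 <=
     (2 * E)%:R * lg N * cN :> R.
    apply: ler_pM => //; [by rewrite mulr_ge0 ?lg_ge0|by rewrite sumr_ge0|].
    by apply: ler_wpM2l.
  have -> : (4 * E)%:R = 2 * (2 * E)%:R :> R by rewrite -natrM mulnA.
  by lra.
have step2 : \sum_(m <- s) \sum_(0 <= q < N.+1 | Qc m q) 1 <= 8 * H%:R * (F_count ustar N)%:R :> R.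
  rewrite F_E mulr_sumr.
  apply: (@le_trans _ _ (\sum_(n <- PR) \sum_(0 <= q < N.+1 | [&& prime q, (y < q)%N & (q %| n)%N]) 1)).
    rewrite (exchange_big_dep (fun q => prime q && (y < q)%N)) /=; last first.
      by move=> ? ? _ /and3P[-> ->].
    rewrite [X in _ <= X](exchange_big_dep (fun q => prime q && (y < q)%N)) /=; last first.
      by move=> ? ? _ /and3P[-> ->].
    apply: ler_sum => q /andP[pq yq]; have q0 := prime_gt0 pq.
    rewrite -big_filter -(big_map (muln^~ q) predT (fun n => 1)).
    apply: ler_sum_sub => //.
    - by rewrite map_inj_uniq ?filter_uniq // => a b /eqP; rewrite eqn_pmul2r // => /eqP.
    - by rewrite filter_uniq // iota_uniq.
    - move=> n /mapP[m]; rewrite mem_filter => /andP[/and3P[_ _ mqN] /Hs[cm m0 Nm _] ->] _.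
      rewrite dvdn_mull // pq yq !andbT mem_filter mem_iota muln_gt0 m0 q0 /= add1n ltnS mqN andbT.
      apply/chain_practical/(chain_mul_prime cm pq (ltn_trans y3 yq)).
      rewrite -(leq_pmul2l m0); apply: leq_trans mqN _; apply: leq_trans Nm _.
      by rewrite expnS expn1.
  rewrite big_seq [X in _ <= X]big_seq; apply: ler_sum => n.
  rewrite mem_filter mem_iota add1n ltnS mulr1 => /andP[_ /andP[n0 nN]].
  rewrite -(ler_pM2r ly).
  apply: (@le_trans _ _ (lg n)).
    rewrite mulr_suml.
    apply: (@le_trans _ _ (\sum_(0 <= q < N.+1 | [&& prime q, (y < q)%N & (q %| n)%N]) lg q)).
      by apply: ler_sum => q /and3P[_ yq _]; rewrite mul1r le_lg // ltnW.
    rewrite -lg_prod; last by move=> q /and3P[/prime_gt0].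
    by apply/le_lg/prod_primes_le => // q _ /and3P[].
  apply: le_trans (le_lg R nN) _; apply: le_trans (le_lg R (ltnW N8)) _.
  by rewrite lgX // natrM.
have NR : 0 <= N%:R :> R by [].
have main : k * k0 * N%:R <= c * (F_count ustar N)%:R * lg N.
  have q1 : k * k0 <= \sum_(m <- s) m%:R^-1.
    by apply: le_trans Ms; apply: ler_wpM2l => //; exact: ltW.
  have q2 := ler_wpM2l NR q1.
  have q3 : (4 * E)%:R * lg N * \sum_(m <- s) \sum_(0 <= q < N.+1 | Qc m q) 1 <=
    (4 * E)%:R * lg N * (8 * H%:R * (F_count ustar N)%:R).
    by apply: ler_wpM2l => //; rewrite mulr_ge0 // ltW.
  by rewrite /c; lra.
have -> : k * k0 / c * (N%:R / lg N) = k * k0 * N%:R / (c * lg N).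
  by field; rewrite !gt_eqF.
have cl : 0 < c * lg N by rewrite mulr_gt0.
by rewrite ler_pdivrMr //; move: main; rewrite mulrA [_ * c]mulrC.
Qed.

Lemma count_practical_lower : exists2 l : R, 0 < l & forall N, (1 < N)%N ->
  l * (N%:R / lg N) <= (F_count ustar N)%:R.
Proof.
have [l l0 [N0 H]] := count_practical_lower_large.
exists (Num.min l (2 * N0.+1%:R)^-1).
  by rewrite lt_min l0 invr_gt0 mulr_gt0 // ltr0n.
move=> N N1; have lN := lg_gt0 R N1.
have r0 : 0 <= N%:R / lg N by rewrite divr_ge0 // ltW.
have [NN|NN] := leqP N0 N.
  apply: le_trans (H N NN); apply: ler_wpM2r => //; by rewrite ge_min lexx.
apply: (@le_trans _ _ 1); last first.
  rewrite ler1n /F_count -has_count; apply/hasP; exists 1%N; first by rewrite mem_iota; lia.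
  by apply: subset_sums_full_practical => //; exact: subset_sums_full1.
apply: (@le_trans _ _ ((2 * N0.+1%:R)^-1 * (N%:R / lg N))).
  by apply: ler_wpM2r => //; rewrite ge_min lexx orbT.
rewrite ler_pdivrMl ?mulr_gt0 ?ltr0n // mulr1 ler_pdivrMr //.
have : N%:R <= N0.+1%:R :> R by rewrite ler_nat; lia.
have := lg_ge_half R N1; have : 0 <= N0.+1%:R :> R by [].
by move: (N0.+1%:R) => a *; nra.
Qed.

End LowerBound.

From mathcomp Require Import Rstruct Rstruct_topology.
From Stdlib Require Import Reals ZArith Lra.

Lemma floor_div_ln_bounds (X : R) (n : nat) : (2 <= INR n)%R -> (INR n <= X < INR n + 1)%R ->
  (X / ln X <= 2 * (INR n / ln (INR n)))%R /\ (INR n / ln (INR n) <= 2 * (X / ln X))%R.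
Proof.
move: (INR n) => a a2 [aX Xa].
have la : (0 < ln a)%R by rewrite -ln_1; apply: ln_increasing; Lra.lra.
have l1 : (ln a <= ln X)%R.
  by case: aX => [h|->]; [left; apply: ln_increasing => //; Lra.lra | right].
have l2 : (ln X <= 2 * ln a)%R.
  have -> : (2 * ln a = ln (a * a))%R by rewrite ln_mult; Lra.lra.
  by left; apply: ln_increasing; [Lra.lra | Lra.nra].
have lX : (0 < ln X)%R by Lra.lra.
have iX : (0 < / ln X)%R by exact: Rinv_0_lt_compat.
have i1 : (/ ln X <= / ln a)%R by apply: Rinv_le_contravar.
have i2 : (/ ln a <= 2 * / ln X)%R.
  have -> : (2 * / ln X = / (ln X / 2))%R by field; Lra.lra.
  by apply: Rinv_le_contravar; Lra.lra.
rewrite /Rdiv; split.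
  rewrite -Rmult_assoc; apply: Rmult_le_compat; Lra.lra.
by have := Rmult_le_compat a X (/ ln a) (2 * / ln X); Lra.lra.
Qed.

Theorem theorem1p8 :
  exists l u : R, (0 < l)%R /\ (0 < u)%R /\
    forall X : R, (2 <= X)%R ->
      (l * (X / ln X) <= INR (F_count ustar (Z.to_nat (Int_part X))))%R /\
      (INR (F_count ustar (Z.to_nat (Int_part X))) <= u * (X / ln X))%R.
Proof.
have [l l0 Hl] := count_practical_lower (R : realType).
have [u u0 Hu] := count_practical_upper (R : realType).
have {}l0 : (0 < l)%R by apply/RltP; exact: l0.
have {}u0 : (0 < u)%R by apply/RltP; exact: u0.
exists (l / 2)%R, (2 * u)%R; split; [Lra.lra | split; [Lra.lra|]] => X X2.
have [I1 I2] := base_Int_part X.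
have I0 : (2 <= Int_part X)%Z.
  by apply: Zlt_succ_le; apply: lt_IZR; rewrite succ_IZR; Lra.lra.
set n := Z.to_nat _.
have nE : INR n = IZR (Int_part X) by rewrite INR_IZR_INZ /n Z2Nat.id //; Lia.lia.
have n2 : (2 <= INR n)%R by rewrite nE; apply: (IZR_le 2).
have [b1 b2] := @floor_div_ln_bounds X n n2 ltac:(by rewrite nE; split; Lra.lra).
have n1 : leq 2 n by apply/ssrnat.leP; apply: INR_le; rewrite /=; Lra.lra.
have {}Hl : (l * (INR n / ln (INR n)) <= INR (F_count ustar n))%R.
  by apply/RleP; rewrite !RealsE; exact: Hl.
have {}Hu : (INR (F_count ustar n) <= u * (INR n / ln (INR n)))%R.
  by apply/RleP; rewrite !RealsE; exact: Hu.
split; Lra.nra.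
Qed.
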